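(* The following two claims are equivalent: (i) There is an algorithm which, given Boolean conjunctive queries $\psi_s,\psi_b$ over a common signature, decides whether $\psi_s\le_\forall\psi_b$ (i.e. $QCP^{bag}_{CQ}$ is decidable). (ii) There is an algorithm which, given a Boolean conjunctive query $\psi_s$ and a Boolean union of conjunctive queries $\Psi_b$ over a common signature, decides whether $\psi_s\le_\forall\Psi_b$.
   Context: All structures are finite relational structures over a signature that may contain constant symbols; the vertex set $\mathcal V(D)$ contains the interpretations of the constants. All queries are Boolean, with all variables implicitly existentially quantified. For a conjunctive query (CQ) $\phi$ and a structure $D$, $\phi\odot D$ denotes the number of maps $h:var(\phi)\to\mathcal V(D)$ such that every atom of $\phi$, after replacing each variable $v$ by $h(v)$ (and constants by their interpretations), is a fact of $D$ (bag-set semantics: $D$ is an ordinary set of facts). A union of conjunctive queries (UCQ) $\Phi=\bigvee_{j=1}^{J}\phi_j$ has pairwise variable-disjoint disjuncts and $\Phi\odot D:=\sum_{j=1}^J\phi_j\odot D$. $\Psi_s\le_\forall\Psi_b$ means $\Psi_s\odot D\le\Psi_b\odot D$ for every structure $D$. *)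

(* Defs.v *)
From mathcomp Require Import all_boot.
Set Implicit Arguments. Unset Strict Implicit. Unset Printing Implicit Defensive.

(* A signature: the list of arities of the relation symbols (symbol i has
   arity nth 0 ar i) and the number of constant symbols. *)
Definition signature := (seq nat * nat)%type.
Definition sig_arities (sg : signature) : seq nat := sg.1.
Definition sig_consts (sg : signature) : nat := sg.2.

(* A term is a variable (inl v) or a constant symbol (inr c). *)
Definition term := (nat + nat)%type.
(* An atom: relation symbol index and argument list. *)
Definition atom := (nat * seq term)%type.
(* A Boolean CQ: a list of atoms (conjunction, all variables existential). *)
Definition cq := seq atom.
Definition ucq := seq cq.

Definition wf_term (sg : signature) (t : term) : bool :=
  if t is inr c then c < sig_consts sg else true.

Definition wf_atom (sg : signature) (a : atom) : bool :=
  [&& a.1 < size (sig_arities sg),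
      size a.2 == nth 0 (sig_arities sg) a.1 &
      all (wf_term sg) a.2].

Definition wf_cq (sg : signature) (q : cq) : bool := all (wf_atom sg) q.
Definition wf_ucq (sg : signature) (Q : ucq) : bool := all (wf_cq sg) Q.

Definition term_vars (t : term) : seq nat := if t is inl v then [:: v] else [::].
Definition cq_vars (q : cq) : seq nat :=
  undup (flatten [seq flatten (map term_vars a.2) | a <- q]).

Record structure (sg : signature) := Structure {
  sz : nat;
  rels : nat -> pred (seq 'I_sz);
  cst : 'I_(sig_consts sg) -> 'I_sz }.

Section Semantics.
Variables (sg : signature) (D : structure sg).

Definition eval_term (vs : seq nat) (h : {ffun 'I_(size vs) -> 'I_(sz D)})
    (t : term) : option 'I_(sz D) :=
  match t with
  | inl v => omap h (insub (index v vs))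
  | inr c => omap (@cst sg D) (insub c)
  end.

Definition atom_holds (vs : seq nat) (h : {ffun 'I_(size vs) -> 'I_(sz D)})
    (a : atom) : bool :=
  let ts := map (eval_term h) a.2 in
  all (fun o => o != None) ts && @rels sg D a.1 (pmap id ts).

Definition cq_count (q : cq) : nat :=
  \sum_(h : {ffun 'I_(size (cq_vars q)) -> 'I_(sz D)})
     (all (atom_holds h) q : nat).

Definition ucq_count (Q : ucq) : nat := sumn (map cq_count Q).
End Semantics.

Definition ucq_le_all (sg : signature) (Ps Pb : ucq) : Prop :=
  forall D : structure sg, ucq_count D Ps <= ucq_count D Pb.

Inductive instr := INC of nat | DECJZ of nat & nat.
Definition program := seq instr.

Record mstate := MState { pc : nat; regs : nat -> nat }.

Definition upd (f : nat -> nat) (r v : nat) : nat -> nat :=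
  fun x => if x == r then v else f x.

Definition step (p : program) (s : mstate) : option mstate :=
  if pc s < size p then
    match nth (INC 0) p (pc s) with
    | INC r => Some (MState (pc s).+1 (upd (regs s) r (regs s r).+1))
    | DECJZ r j =>
        if regs s r == 0 then Some (MState j (regs s))
        else Some (MState (pc s).+1 (upd (regs s) r (regs s r).-1))
    end
  else None.

Fixpoint run (k : nat) (p : program) (s : mstate) : option mstate :=
  match step p s with
  | None => Some s
  | Some s' => if k is k'.+1 then run k' p s' else None
  end.

Definition init_state (n : nat) : mstate := MState 0 (fun r => if r == 0 then n else 0).

Definition algorithmically_decidable (T : countType) (Wf : T -> bool)
    (P : T -> Prop) : Prop :=
  exists p : program, forall x : T, Wf x ->
    exists k s, run k p (init_state (pickle x)) = Some s /\
                (regs s 0 = 1 <-> P x).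

Definition wf_cq_cq (x : signature * cq * cq) : bool :=
  wf_cq x.1.1 x.1.2 && wf_cq x.1.1 x.2.
Definition QCP_CQ (x : signature * cq * cq) : Prop :=
  ucq_le_all x.1.1 [:: x.1.2] [:: x.2].

Definition wf_cq_ucq (x : signature * cq * ucq) : bool :=
  wf_cq x.1.1 x.1.2 && wf_ucq x.1.1 x.2.
Definition QCP_CQ_UCQ (x : signature * cq * ucq) : Prop :=
  ucq_le_all x.1.1 [:: x.1.2] x.2.

(* Main.v *)
Require Import Defs.
From mathcomp Require Import all_boot.
From Stdlib Require Import FunctionalExtensionality.
Set Implicit Arguments. Unset Strict Implicit. Unset Printing Implicit Defensive.

(* A single CQ is a one-element UCQ, so (ii) implies (i).  Conversely, given psi
   and Phi = phi_1 \/ ... \/ phi_J, add to every relation an extra argument, its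
   world, and keep only two constants a and b; the old constants become
   variables, tied to a world by a new relation W.  The small query asks for psi
   in world a, and for world b to be trivial: it contains every fact all of whose
   arguments are b.  The big query asks for a path of J edges
     E(s_J, x_J, s_{J-1}), ..., E(s_1, x_1, s_0)   with  E(a,b,s_J), E(s_0,s_0,s_0)
   such that phi_j holds in world x_j and psi holds in world s_0; the small query
   forces the edges E(a,b,a), E(a,a,b) and E(b,b,b).  If a <> b, the path can
   switch from a to b at any j, which evaluates phi_j in world a and every other
   conjunct in world b, where its count is at least 1: so the big count is at
   least the sum of the phi_j.  If a = b, the constant path already counts at least
   psi in world s_0 = b = a.  In the structure obtained from D by adding two points
   a, b and only the required facts, both bounds are equalities.

   On the computational side, [pickle] of a list [x :: s] is
   2 ^ pickle x * (2 * pickle s + 1).  This pairing is used as a stack kept in one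
   register, so that computable functions compose with a fixed set of registers. *)

(** * Counter machines and computable functions *)

(** [While r] removes one unit of [r] at each test, because [DECJZ] couples the test with the
    decrement. *)
Inductive cmd :=
  | Skip | Inc of nat | Dec of nat | Seq of cmd & cmd | While of nat & cmd.
Infix ";;" := Seq (at level 60, right associativity).

(* Register 2 must be 0 at the end of each loop body: testing it is how the
   compiled code jumps back unconditionally. *)
Inductive exec : cmd -> (nat -> nat) -> (nat -> nat) -> Prop :=
  | ExecSkip f : exec Skip f f
  | ExecInc r f : exec (Inc r) f (upd f r (f r).+1)
  | ExecDec r f : exec (Dec r) f (upd f r (f r).-1)
  | ExecSeq c d f g h : exec c f g -> exec d g h -> exec (c ;; d) f h
  | ExecDone r c f : f r = 0 -> exec (While r c) f f
  | ExecLoop r c n f g h : f r = n.+1 -> exec c (upd f r n) g -> g 2 = 0 ->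
      exec (While r c) g h -> exec (While r c) f h.

(** Jump targets are absolute, so [off] is the address at which the code will be placed. *)
Fixpoint compile (c : cmd) (off : nat) : program :=
  match c with
  | Skip => [::]
  | Inc r => [:: INC r]
  | Dec r => [:: DECJZ r off.+1]
  | Seq c d =>
      let p := compile c off in p ++ compile d (off + size p)
  | While r c =>
      let p := compile c off.+1 in
      DECJZ r (off.+1 + size p).+1 :: rcons p (DECJZ 2 off)
  end.

(** Quantifying over the leftover fuel [k] makes segments of a run compose. *)
Definition reach (p : program) (s t : mstate) :=
  exists n, forall k, run (n + k) p s = run k p t.

Lemma reach_refl p s : reach p s s.
Proof. by exists 0. Qed.

Lemma reach_trans p t s u : reach p s t -> reach p t u -> reach p s u.
Proof.
by move=> [m Hm] [n Hn]; exists (m + n) => k; rewrite -addnA Hm Hn.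
Qed.

Lemma reach_step p s t : step p s = Some t -> reach p s t.
Proof. by move=> e; exists 1 => k /=; rewrite e. Qed.

Lemma updxx f r : upd f r (f r) = f.
Proof. by apply: functional_extensionality => x; rewrite /upd; case: eqP => // ->. Qed.

(** Induction on the execution; the surrounding code [p1], [p2] must vary, since a subcommand sees
    its siblings as context. *)
Lemma compileP c f g : exec c f g -> forall p1 p2,
  let code := compile c (size p1) in
  reach (p1 ++ code ++ p2) (MState (size p1) f) (MState (size p1 + size code) g).
Proof.
have nth_at p1 i p2 : nth (INC 0) (p1 ++ i :: p2) (size p1) = i.
  by rewrite nth_cat ltnn subnn.
have lt_at p1 (i : instr) p2 : size p1 < size (p1 ++ i :: p2).
  by rewrite size_cat /= -addSnnS leq_addr.
elim=> {c f g}
  [f|r f|r f|c d f g h _ IHc _ IHd|r c f f0|r c n f g h fn _ IHc g2 _ IHw] p1 p2 /=.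
- by rewrite addn0; apply: reach_refl.
- by apply: reach_step; rewrite /step lt_at /= nth_at addn1.
- apply: reach_step; rewrite /step lt_at /= nth_at addn1.
  (* On a zero register [DECJZ] jumps to the next instruction anyway, in agreement with
     [0.-1 = 0]. *)
  case: eqP => // fr; have -> // : upd f r (f r).-1 = f.
  by rewrite fr /= -fr updxx.
- rewrite -catA; apply: reach_trans (IHc p1 _) _.
  have := IHd (p1 ++ compile c (size p1)) p2.
  by rewrite /= !size_cat !catA addnA.
- apply: reach_step; rewrite /step lt_at /= nth_at /= f0 /=.
  by rewrite size_rcons addSn !addnS.
- set code := compile c _; set i := DECJZ r _; set j := DECJZ 2 _.
  have -> : p1 ++ i :: rcons code j ++ p2 = rcons p1 i ++ code ++ j :: p2.
    by rewrite cat_rcons cat_rcons.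
  apply: (@reach_trans _ (MState (size p1).+1 (upd f r n))).
    by apply: reach_step; rewrite /step cat_rcons lt_at /= nth_at /= fn.
  have := IHc (rcons p1 i) (j :: p2); rewrite /= size_rcons => H.
  apply: reach_trans H _; rewrite -/code.
  have -> : rcons p1 i ++ code ++ j :: p2 = p1 ++ i :: rcons code j ++ p2.
    by rewrite cat_rcons cat_rcons.
  apply: reach_trans (IHw p1 p2); apply: reach_step.
  have -> : p1 ++ i :: rcons code j ++ p2 = (p1 ++ i :: code) ++ j :: p2.
    by rewrite -catA /= cat_rcons.
  have -> : (size p1).+1 + size code = size (p1 ++ i :: code).
    by rewrite size_cat /= addSnnS.
  by rewrite /step lt_at /= nth_at /= g2.
Qed.

Definition shift (off : nat) (i : instr) : instr :=
  if i is DECJZ r j then DECJZ r (off + j) else i.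

(** Shifted code never jumps back into [pre], so both runs proceed in lockstep, and they halt
    together because [p] is placed last. *)
Lemma run_shift pre p k s :
  run k (pre ++ map (shift (size pre)) p) (MState (size pre + pc s) (regs s)) =
  omap (fun t => MState (size pre + pc t) (regs t)) (run k p s).
Proof.
have stepE s' : step (pre ++ map (shift (size pre)) p)
      (MState (size pre + pc s') (regs s')) =
    omap (fun t => MState (size pre + pc t) (regs t)) (step p s').
  rewrite /step /= size_cat size_map ltn_add2l; case: ifP => // lt_p.
  rewrite nth_cat ltnNge leq_addr /= addKn (nth_map (INC 0)) //.
  case: (nth _ p _) => [r|r j] /=; first by rewrite addnS.
  by case: ifP; rewrite //= addnS.
elim: k s => [|k IHk] s /=; rewrite stepE; case: (step p s) => //=.
Qed.

(** * Arithmetic and stack operations on registers *)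

Section Registers.
Implicit Types (l : seq nat) (c : cmd).

Notation R := (nth 0).

(** Register files are written as lists read with default 0, so that updates of explicit files
    reduce by computation. *)
Lemma upd_nth l r v : upd (R l) r v = R (set_nth 0 l r v).
Proof. by apply: functional_extensionality => x; rewrite nth_set_nth. Qed.

Lemma exec_inc r l : exec (Inc r) (R l) (R (set_nth 0 l r (R l r).+1)).
Proof. by rewrite -upd_nth; constructor. Qed.

Lemma exec_dec r l : exec (Dec r) (R l) (R (set_nth 0 l r (R l r).-1)).
Proof. by rewrite -upd_nth; constructor. Qed.

Lemma exec_loop r c n l l' f : R l r = n.+1 ->
  exec c (R (set_nth 0 l r n)) (R l') -> R l' 2 = 0 ->
  exec (While r c) (R l') f -> exec (While r c) (R l) f.
Proof. by rewrite -upd_nth; apply: ExecLoop. Qed.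

Definition mv (r q : nat) := While r (Inc q).

Lemma exec_mv (r q : nat) l : r != q -> r != 2 -> q != 2 -> R l 2 = 0 ->
  exec (mv r q) (R l) (R (set_nth 0 (set_nth 0 l q (R l r + R l q)) r 0)).
Proof.
move=> rq r2 q2; have qr : q != r by rewrite eq_sym.
rewrite -!upd_nth; move: (R l) => f.
move En: (f r) => n; elim: n f En => [|n IHn] f En f2.
  by rewrite updxx; have := updxx f r; rewrite En => ->; apply: ExecDone.
apply: ExecLoop En (ExecInc _ _) _ _.
  by rewrite /upd eq_sym (negbTE q2) eq_sym (negbTE r2).
set g := upd _ q _.
have -> : upd (upd f q (n.+1 + f q)) r 0 = upd (upd g q (n + g q)) r 0.
  apply: functional_extensionality => x; rewrite /g /upd eqxx (negbTE qr).
  by rewrite addSnnS; case: (x == r); case: (x == q).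
apply: IHn; rewrite /g /upd ?eqxx ?(negbTE rq) //.
by rewrite eq_sym (negbTE q2) eq_sym (negbTE r2).
Qed.

Definition consN (n m : nat) : nat := 2 ^ n * m.*2.+1.

Definition double := While 1 (Inc 3 ;; Inc 3) ;; mv 3 1.

Lemma exec_double1 x m tl :
  exec (While 1 (Inc 3 ;; Inc 3)) (R [:: x, m, 0, 0 & tl])
       (R [:: x, 0, 0, m.*2 & tl]).
Proof.
suff H k : exec (While 1 (Inc 3;; Inc 3)) (R [:: x, m, 0, k & tl])
    (R [:: x, 0, 0, m.*2 + k & tl]) by have := H 0; rewrite addn0.
elim: m k => [|m IHm] k; first exact: ExecDone.
apply: (@exec_loop _ _ m _ [:: x, m, 0, k.+2 & tl]) => //.
  by apply: ExecSeq (exec_inc _ _) _; apply: exec_inc.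
by rewrite doubleS !addSnnS; apply: IHm.
Qed.

Lemma exec_double x m tl :
  exec double (R [:: x, m, 0, 0 & tl]) (R [:: x, m.*2, 0, 0 & tl]).
Proof.
apply: ExecSeq (exec_double1 _ _ _) _.
by have := @exec_mv 3 1 [:: x, 0, 0, m.*2 & tl]; rewrite /= addn0; apply.
Qed.

(** The value 2m+1 is built in register 3, returned to register 1, and doubled once for each unit of
    register 0. *)
Definition push :=
  While 1 (Inc 3 ;; Inc 3) ;; Inc 3 ;; mv 3 1 ;; While 0 double.

Lemma exec_push x m tl :
  exec push (R [:: x, m, 0, 0 & tl]) (R [:: 0, consN x m, 0, 0 & tl]).
Proof.
apply: ExecSeq (exec_double1 _ _ _) _; apply: ExecSeq (exec_inc _ _) _ => /=.
apply: ExecSeq; first exact: exec_mv.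
rewrite /= addn0 /consN; elim: x m.*2.+1 => [|x IHx] n.
  by rewrite mul1n; apply: ExecDone.
apply: (@exec_loop _ _ x _ [:: x, n.*2, 0, 0 & tl]) => //.
  exact: exec_double.
by rewrite expnSr -mulnA mul2n; apply: IHx.
Qed.

(* Register 1 is moved to register 3 at half speed; register 4 holds the parity
   of the number of units moved so far. *)
Definition halve :=
  While 1 (Inc 5 ;; While 4 (Inc 3 ;; Dec 5) ;; While 5 (Inc 4)).

Lemma exec_halve x m tl :
  exec halve (R [:: x, m, 0, 0, 0, 0 & tl])
       (R [:: x, 0, 0, m./2, odd m : nat, 0 & tl]).
Proof.
suff H n : exec halve (R [:: x, m, 0, n./2, odd n : nat, 0 & tl])
    (R [:: x, 0, 0, (m + n)./2, odd (m + n) : nat, 0 & tl]).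
  by have := H 0; rewrite addn0.
elim: m n => [|m IHm] n; first exact: ExecDone.
apply: (@exec_loop _ _ m _
  [:: x, m, 0, uphalf n, ~~ odd n : nat, 0 & tl]) => //; last first.
  by rewrite addSnnS; apply: (IHm n.+1).
apply: ExecSeq (exec_inc _ _) _; rewrite uphalf_half /=.
case: (odd n) => /=.
  apply: ExecSeq; last exact: ExecDone.
  apply: (@exec_loop _ _ 0 _ [:: x, m, 0, (n./2).+1, 0, 0 & tl]) => //.
    by apply: ExecSeq (exec_inc _ _) _; apply: exec_dec.
  exact: ExecDone.
apply: ExecSeq; first exact: ExecDone.
apply: (@exec_loop _ _ 0 _ [:: x, m, 0, n./2, 1, 0 & tl]) => //.
  exact: exec_inc.
exact: ExecDone.
Qed.

(** Register 6 flags a further pass. Each pass halves register 1: an even value adds one to register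
    0 and raises the flag again, and the first odd value 2m+1 leaves m and ends the loop. *)
Definition pop_loop :=
  While 6 (halve ;; Inc 5 ;; While 4 (Dec 5) ;;
           While 5 (Inc 0 ;; Inc 6) ;; mv 3 1).

Definition pop := Inc 6 ;; pop_loop.

Lemma exec_pop x m tl :
  exec pop (R [:: 0, consN x m, 0, 0, 0, 0, 0 & tl])
       (R [:: x, m, 0, 0, 0, 0, 0 & tl]).
Proof.
apply: ExecSeq (exec_inc _ _) _ => /=.
suff H y : exec pop_loop (R [:: y, consN x m, 0, 0, 0, 0, 1 & tl])
                  (R [:: y + x, m, 0, 0, 0, 0, 0 & tl]) by apply: (H 0).
rewrite /consN; elim: x y => [|x IHx] y.
  rewrite mul1n addn0.
  apply: (@exec_loop _ _ 0 _ [:: y, m, 0, 0, 0, 0, 0 & tl]) => //; last first.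
    exact: ExecDone.
  apply: ExecSeq (exec_halve _ _ _) _.
  rewrite /= odd_double uphalf_double; apply: ExecSeq (exec_inc _ _) _ => /=.
  apply: (@ExecSeq _ _ _ (R [:: y, 0, 0, m, 0, 0, 0 & tl])).
    apply: (@exec_loop _ _ 0 _ [:: y, 0, 0, m, 0, 0, 0 & tl]) => //.
      exact: exec_dec.
    exact: ExecDone.
  apply: ExecSeq; first exact: ExecDone.
  by have := @exec_mv 3 1 [:: y, 0, 0, m, 0, 0, 0 & tl]; rewrite /= addn0; apply.
set n := 2 ^ x * m.*2.+1.
have -> : 2 ^ x.+1 * m.*2.+1 = n.*2 by rewrite expnS -mulnA mul2n.
apply: (@exec_loop _ _ 0 _ [:: y.+1, n, 0, 0, 0, 0, 1 & tl]) => //; last first.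
  by rewrite -addSnnS; apply: IHx.
apply: ExecSeq (exec_halve _ _ _) _.
rewrite /= odd_double doubleK; apply: ExecSeq (exec_inc _ _) _ => /=.
apply: ExecSeq; first exact: ExecDone.
apply: (@ExecSeq _ _ _ (R [:: y.+1, 0, 0, n, 0, 0, 1 & tl])).
  apply: (@exec_loop _ _ 0 _ [:: y.+1, 0, 0, n, 0, 0, 1 & tl]) => //.
    by apply: ExecSeq (exec_inc _ _) _; apply: exec_inc.
  exact: ExecDone.
by have := @exec_mv 3 1 [:: y.+1, 0, 0, n, 0, 0, 1 & tl]; rewrite /= addn0; apply.
Qed.

(* Register 0 is the accumulator, register 1 a stack coded by [consN], register 2
   stays 0, and registers 3 to 9 are scratch; only [dig] uses register 9. *)
Definition state (x s w : nat) := R [:: x; s; 0; 0; 0; 0; 0; 0; 0; w].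

Ltac seq_mv := apply: ExecSeq; first exact: exec_mv; rewrite /= ?add0n ?addn0.
Ltac last_mv a b :=
  match goal with |- exec _ (nth 0 ?l) _ =>
    have := @exec_mv a b l; rewrite /= ?add0n ?addn0; apply end.

Definition dup := While 0 (Inc 7 ;; Inc 8) ;; mv 7 0 ;; push ;; mv 8 0.

Lemma exec_dup x s w : exec dup (state x s w) (state x (consN x s) w).
Proof.
apply: (@ExecSeq _ _ _ (R [:: 0; s; 0; 0; 0; 0; 0; x; x; w])).
  suff H k : exec (While 0 (Inc 7;; Inc 8)) (R [:: x; s; 0; 0; 0; 0; 0; k; k; w])
      (R [:: 0; s; 0; 0; 0; 0; 0; x + k; x + k; w]).
    by have := H 0; rewrite addn0.
  elim: x k => [|x IHx] k; first exact: ExecDone.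
  apply: (@exec_loop _ _ x _ [:: x; s; 0; 0; 0; 0; 0; k.+1; k.+1; w]) => //.
    by apply: ExecSeq (exec_inc _ _) _; apply: exec_inc.
  by rewrite addSnnS; apply: IHx.
seq_mv; apply: ExecSeq (exec_push _ _ _) _.
by last_mv 8 0.
Qed.

Definition swap := mv 0 7 ;; pop ;; mv 0 8 ;; mv 7 0 ;; push ;; mv 8 0.

Lemma exec_swap x y s w :
  exec swap (state x (consN y s) w) (state y (consN x s) w).
Proof.
seq_mv; apply: ExecSeq (exec_pop _ _ _) _; seq_mv; seq_mv.
by apply: ExecSeq (exec_push _ _ _) _; last_mv 8 0.
Qed.

Definition join := mv 0 7 ;; pop ;; mv 1 8 ;; mv 7 1 ;; push ;; mv 1 0 ;; mv 8 1.

Lemma exec_join x y s w :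
  exec join (state x (consN y s) w) (state (consN y x) s w).
Proof.
seq_mv; apply: ExecSeq (exec_pop _ _ _) _; seq_mv; seq_mv.
by apply: ExecSeq (exec_push _ _ _) _; seq_mv; last_mv 8 1.
Qed.

Definition uncons := mv 1 8 ;; mv 0 1 ;; pop ;; mv 1 7 ;; mv 8 1 ;; push ;; mv 7 0.

Lemma exec_uncons x y s w :
  exec uncons (state (consN y x) s w) (state x (consN y s) w).
Proof.
seq_mv; seq_mv; apply: ExecSeq (exec_pop _ _ _) _; seq_mv; seq_mv.
by apply: ExecSeq (exec_push _ _ _) _; last_mv 7 0.
Qed.

(** The accumulator is parked in register 9 because [swap] uses registers 7 and 8. *)
Definition dig := mv 0 9 ;; pop ;; swap ;; push ;; mv 9 0.

Lemma exec_dig x y z s :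
  exec dig (state x (consN y (consN z s)) 0) (state x (consN z (consN y s)) 0).
Proof.
seq_mv; apply: ExecSeq (exec_pop _ _ _) _; apply: ExecSeq (exec_swap _ _ _ _) _.
by apply: ExecSeq (exec_push _ _ _) _; last_mv 9 0.
Qed.

Definition clear := While 0 Skip.

Lemma exec_clear x s w : exec clear (state x s w) (state 0 s w).
Proof.
elim: x => [|x IHx]; first exact: ExecDone.
by apply: exec_loop IHx => //; apply: ExecSkip.
Qed.

End Registers.

(** The stack [s] is arbitrary and must be preserved: intermediate results can wait there while
    another program runs. *)
Definition computable (T U : countType) (f : T -> U) : Prop :=
  exists c, forall x s, exec c (state (pickle x) s 0) (state (pickle (f x)) s 0).

(** * Closure properties of computable functions *)

Section Closure.
Implicit Types G T U : countType.

(** Programs see only codes; this is how pairs and sums are reduced to lists. *)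
Lemma computable_pickle G T U (f : G -> T) (g : G -> U) :
  computable f -> (forall x, pickle (f x) = pickle (g x)) -> computable g.
Proof. by move=> [c Hc] fg; exists c => x s; rewrite -fg. Qed.

Lemma computable_eq G T (f g : G -> T) : computable f -> f =1 g -> computable g.
Proof. by move=> Hf fg; apply: computable_pickle Hf _ => x; rewrite fg. Qed.

Lemma computable_id T : computable (@id T).
Proof. by exists Skip => x s; apply: ExecSkip. Qed.

Lemma computable_comp G T U (f : T -> U) (g : G -> T) :
  computable f -> computable g -> computable (fun x => f (g x)).
Proof.
by move=> [c Hc] [d Hd]; exists (d ;; c) => x s; apply: ExecSeq (Hd _ _) (Hc _ _).
Qed.

Lemma computable_cst G T (y : T) : computable (fun _ : G => y).
Proof.
exists (clear ;; iter (pickle y) (Seq^~ (Inc 0)) Skip) => x s.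
apply: ExecSeq (exec_clear _ _ _) _.
elim: (pickle y) => [|n IHn]; first exact: ExecSkip.
by apply: ExecSeq IHn _; apply: exec_inc.
Qed.

Lemma computable_succ G (f : G -> nat) :
  computable f -> computable (fun x => (f x).+1).
Proof. by apply: computable_comp; exists (Inc 0) => x s; apply: exec_inc. Qed.

Lemma computable_cons G T (f : G -> T) (g : G -> seq T) :
  computable f -> computable g -> computable (fun x => f x :: g x).
Proof.
move=> [c Hc] [d Hd]; exists (dup ;; c ;; swap ;; d ;; join) => x s.
apply: ExecSeq (exec_dup _ _ _) _; apply: ExecSeq (Hc _ _) _.
apply: ExecSeq (exec_swap _ _ _ _) _; apply: ExecSeq (Hd _ _) _.
exact: exec_join.
Qed.

Lemma computable_pair G T U (f : G -> T) (g : G -> U) :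
  computable f -> computable g -> computable (fun x => (f x, g x)).
Proof.
move=> Hf Hg.
(* By computation, a pair has the code of the two-element list of its components' codes. *)
apply: (@computable_pickle _ _ _ (fun x => [:: pickle (f x); pickle (g x)])) => //.
apply: computable_cons; first exact: computable_pickle Hf _.
apply: computable_cons; first exact: computable_pickle Hg _.
exact: computable_cst.
Qed.

Lemma computable_snd G T U (f : G -> T * U) :
  computable f -> computable (fun x => (f x).2).
Proof.
(* After two [uncons] the accumulator holds the code 0 of the empty list, as [pop] requires. *)
apply: computable_comp; exists (uncons ;; uncons ;; pop ;; swap ;; clear ;; pop).
move=> [x y] s; apply: ExecSeq (exec_uncons _ _ _ _) _.
apply: ExecSeq (exec_uncons _ _ _ _) _; apply: ExecSeq (exec_pop _ _ _) _.
apply: ExecSeq (exec_swap _ _ _ _) _; apply: ExecSeq (exec_clear _ _ _) _.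
exact: exec_pop.
Qed.

Lemma computable_fst G T U (f : G -> T * U) :
  computable f -> computable (fun x => (f x).1).
Proof.
apply: computable_comp; exists (uncons ;; clear ;; pop).
move=> [x y] s; apply: ExecSeq (exec_uncons _ _ _ _) _.
apply: ExecSeq (exec_clear _ _ _) _; exact: exec_pop.
Qed.

(** The parameter travels in a pair with the iterated value. The counter occupies the accumulator
    and the pair the top of the stack. *)
Lemma computable_iter G T (n : G -> nat) (f : G -> T -> T) (g : G -> T) :
  computable n -> computable (fun p => f p.1 p.2) -> computable g ->
  computable (fun x => iter (n x) (f x) (g x)).
Proof.
move=> Hn Hf Hg.
suff [c Hc] : computable (fun p : nat * (G * T) =>
    iter p.1 (fun q => (q.1, f q.1 q.2)) p.2).
  have H : computable (fun x => (n x, (x, g x))).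
    by do ?[apply: computable_pair => //]; apply: computable_id.
  apply: computable_eq (computable_snd (computable_comp (ex_intro _ c Hc) H)) _.
  move=> x /=; suff -> m : iter m (fun q => (q.1, f q.1 q.2)) (x, g x) =
    (x, iter m (f x) (g x)) by [].
  by elim: m => //= m ->.
have [c Hc] : computable (fun q : G * T => (q.1, f q.1 q.2)).
  by apply: computable_pair Hf; apply: computable_fst; apply: computable_id.
exists (uncons ;; uncons ;; pop ;; swap ;; While 0 (swap ;; c ;; swap) ;; pop).
move=> [m q] s; apply: ExecSeq (exec_uncons _ _ _ _) _.
apply: ExecSeq (exec_uncons _ _ _ _) _; apply: ExecSeq (exec_pop _ _ _) _.
apply: ExecSeq (exec_swap _ _ _ _) _.
apply: ExecSeq (exec_pop _ _ _); rewrite /=.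
elim: m q => [|m IHm] q; first exact: ExecDone.
rewrite iterSr; set q' := (_, _).
apply: (@exec_loop _ _ m _ [:: m; consN (pickle q') s; 0; 0; 0; 0; 0; 0; 0; 0]) => //;
  last exact: IHm.
apply: ExecSeq (exec_swap _ _ _ _) _; apply: ExecSeq (Hc _ _) _.
exact: exec_swap.
Qed.

(** A list has code 0 exactly when it is empty, so [While 0] on the remaining list ends at the right
    moment. *)
Lemma computable_foldl G T U (f : G -> U -> T -> U) (g : G -> U) (l : G -> seq T) :
  computable (fun p => f p.1.1 p.1.2 p.2) -> computable g -> computable l ->
  computable (fun x => foldl (f x) (g x) (l x)).
Proof.
move=> Hf Hg Hl; pose step (q : G * U) a := (q.1, f q.1 q.2 a).
suff [c Hc] : computable (fun p : seq T * (G * U) => foldl step p.2 p.1).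
  have H : computable (fun x => (l x, (x, g x))).
    by do ?[apply: computable_pair => //]; apply: computable_id.
  apply: computable_eq (computable_snd (computable_comp (ex_intro _ c Hc) H)) _.
  move=> x /=; suff -> m b : foldl step (x, b) m = (x, foldl (f x) b m) by [].
  by elim: m b => //= a m IHm b; rewrite IHm.
have [c Hc] : computable (fun p : G * U * T => step p.1 p.2).
  apply: computable_pair Hf; apply: computable_fst; apply: computable_fst.
  exact: computable_id.
exists (uncons ;; uncons ;; pop ;; swap ;;
  While 0 (Inc 0 ;; uncons ;; swap ;; dig ;; push ;; join ;; join ;; c ;; swap) ;;
  pop).
move=> [m q] s; apply: ExecSeq (exec_uncons _ _ _ _) _.
apply: ExecSeq (exec_uncons _ _ _ _) _; apply: ExecSeq (exec_pop _ _ _) _.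
apply: ExecSeq (exec_swap _ _ _ _) _.
apply: ExecSeq (exec_pop _ _ _); rewrite /=.
elim: m q => [|a m IHm] q; first exact: ExecDone.
have pos : 0 < consN (pickle a) (pickle m) by rewrite muln_gt0 expn_gt0.
apply: (@exec_loop _ _ (consN (pickle a) (pickle m)).-1 _
  [:: pickle m; consN (pickle (step q a)) s; 0; 0; 0; 0; 0; 0; 0; 0]) => //;
  last exact: IHm.
  by rewrite /= prednK.
(* [Inc 0] restores the unit taken by the loop test. The stack operations then assemble the code of
   [(q, a)], leaving the tail of the list on the stack. *)
apply: ExecSeq (exec_inc _ _) _; rewrite /= prednK //.
apply: ExecSeq (exec_uncons _ _ _ _) _; apply: ExecSeq (exec_swap _ _ _ _) _.
apply: ExecSeq (exec_dig _ _ _ _) _; apply: ExecSeq (exec_push _ _ _) _.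
apply: ExecSeq (exec_join _ _ _ _) _; apply: ExecSeq (exec_join _ _ _ _) _.
apply: ExecSeq (Hc (q, a) _) _; exact: exec_swap.
Qed.

End Closure.

(** * Computable list operations *)

Section Lists.
Implicit Types G T U : countType.

Lemma computable_rev G T (l : G -> seq T) :
  computable l -> computable (fun x => rev (l x)).
Proof.
move=> Hl; apply: computable_eq (_ : computable
  (fun x => foldl (fun s a => a :: s) [::] (l x))) _.
  apply: computable_foldl Hl; last exact: computable_cst.
  apply: computable_cons; first exact: computable_snd (computable_id _).
  exact: computable_snd (computable_fst (computable_id _)).
by move=> x /=; rewrite /rev; elim: (l x) [::] => //= a m IHm s.
Qed.

Lemma computable_foldr G T U (f : G -> T -> U -> U) (g : G -> U) (l : G -> seq T) :
  computable (fun p => f p.1.1 p.1.2 p.2) -> computable g -> computable l ->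
  computable (fun x => foldr (f x) (g x) (l x)).
Proof.
move=> Hf Hg Hl; apply: computable_eq (_ : computable
  (fun x => foldl (fun b a => f x a b) (g x) (rev (l x)))) _; last first.
  by move=> x /=; rewrite foldl_rev.
apply: computable_foldl Hg (computable_rev Hl).
pose swap (p : G * U * T) := (p.1.1, p.2, p.1.2).
apply: (computable_comp (g := swap) Hf).
have Hid := computable_id (G * U * T)%type.
do ?apply: computable_pair; last exact: computable_snd (computable_fst Hid).
  exact: computable_fst (computable_fst Hid).
exact: computable_snd Hid.
Qed.

Lemma computable_map G T U (f : G -> T -> U) (l : G -> seq T) :
  computable (fun p => f p.1 p.2) -> computable l ->
  computable (fun x => map (f x) (l x)).
Proof.
move=> Hf Hl; apply: (@computable_foldr _ _ _ (fun x a s => f x a :: s)) => //.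
  apply: computable_cons; last exact: computable_snd (computable_id _).
  exact: (computable_comp Hf (computable_fst (computable_id _))).
exact: computable_cst.
Qed.

Lemma computable_cat G T (l1 l2 : G -> seq T) :
  computable l1 -> computable l2 -> computable (fun x => l1 x ++ l2 x).
Proof.
move=> H1 H2; apply: computable_eq (_ : computable
  (fun x => foldr cons (l2 x) (l1 x))) _; last first.
  by move=> x; elim: (l1 x) => //= a s ->.
apply: computable_foldr H2 H1; apply: computable_cons.
  exact: computable_snd (computable_fst (computable_id _)).
exact: computable_snd (computable_id _).
Qed.

Lemma computable_nseq G T (n : G -> nat) (f : G -> T) :
  computable n -> computable f -> computable (fun x => nseq (n x) (f x)).
Proof.
move=> Hn Hf; apply: (@computable_iter _ _ _ (fun x => cons (f x))) => //.
  apply: computable_cons; last exact: computable_snd (computable_id _).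
  exact: (computable_comp Hf (computable_fst (computable_id _))).
exact: computable_cst.
Qed.

Lemma computable_iota G (n : G -> nat) :
  computable n -> computable (fun x => iota 0 (n x)).
Proof.
move=> Hn; pose next (p : nat * seq nat) := (p.1.+1, p.1 :: p.2).
apply: computable_eq (_ : computable
  (fun x => rev (iter (n x) next (0, [::])).2)) _.
  apply: computable_rev; apply: computable_snd.
  apply: (@computable_iter _ _ _ (fun=> next)) => //; last exact: computable_cst.
  have H := computable_snd (computable_id (G * (nat * seq nat))%type).
  apply: computable_pair; first exact: computable_succ (computable_fst H).
  by apply: computable_cons; [apply: computable_fst | apply: computable_snd].
move=> x; suff -> m : iter m next (0, [::]) = (m, rev (iota 0 m)) by rewrite revK.
elim: m => //= m ->; rewrite /next -/(iota 0 m.+1); congr pair.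
by rewrite -[m.+1]addn1 iotaD rev_cat.
Qed.

End Lists.

(** The code of [f] is followed by the shifted decider. The first phase leaves all registers but the
    accumulator at 0, which is an [init_state]. *)
Lemma decidable_reduction (T U : countType) (WT : T -> bool) (WU : U -> bool)
    (P : T -> Prop) (Q : U -> Prop) (f : T -> U) :
  computable f -> (forall x, WT x -> WU (f x)) ->
  (forall x, WT x -> P x <-> Q (f x)) ->
  algorithmically_decidable WU Q -> algorithmically_decidable WT P.
Proof.
move=> [c Hc] Wf fP [p Hp]; pose pre := compile c 0.
exists (pre ++ map (shift (size pre)) p) => x Wx.
have [k [s [runs sQ]]] := Hp _ (Wf x Wx).
have [n Hn] := compileP (Hc x 0) [::] (map (shift (size pre)) p).
have initE y : init_state y = MState 0 (state y 0 0).
  congr MState; apply: functional_extensionality => r; rewrite /state.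
  by case: r => // r; do 9!case: r => // r; rewrite nth_default.
exists (n + k), (MState (size pre + pc s) (regs s)); split; last first.
  exact: iff_trans sQ (iff_sym (fP x Wx)).
rewrite initE (Hn k) /= add0n.
have := run_shift pre p k (init_state (pickle (f x))).
by rewrite runs initE /= addn0.
Qed.

(** * The encoding *)

Definition cstA : term := inr 0.
Definition cstB : term := inr 1.

(* Variables are named by pairs (k, u), where k is the position of a conjunct:
   u = 0 is the state s_k, u = 1 the world x_k, and u >= 2 codes the term of the
   original disjunct (variable or constant) that the variable stands for. *)
Definition name (k u : nat) : term := inl (pickle (k, u)).
Definition stvar (k : nat) : term := name k 0.
Definition wvar (k : nat) : term := name k 1.
Definition ren (k : nat) (t : term) : term := name k (pickle t).+2.

Definition edge (s x t : term) : atom := (0, [:: s; x; t]).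

(** Relation 1 is [W], whose arguments are a world and one value per old constant; old relations
    move up by 2. *)
Definition block (w : term) (k m : nat) (q : cq) : cq :=
  (1, w :: [seq ren k (inr c) | c <- iota 0 m]) ::
  [seq (a.1.+2, w :: map (ren k) a.2) | a : atom <- q].

(** Links are numbered from the end, so the chain of a suffix of [Q] is a literal suffix of the
    chain of [Q]. *)
Fixpoint chain (m : nat) (psi : cq) (Q : ucq) : cq :=
  if Q is phi :: Q' then
    let k := (size Q').+1 in
    edge (stvar k) (wvar k) (stvar (size Q')) ::
      block (wvar k) k m phi ++ chain m psi Q'
  else edge (stvar 0) (stvar 0) (stvar 0) :: block (stvar 0) 0 m psi.

(** On the arities of [world_sig] these atoms include the loop [E(b,b,b)] and [W(b,...,b)]. *)
Definition ground (ars : seq nat) : cq :=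
  [seq (i, nseq (nth 0 ars i) cstB) | i <- iota 0 (size ars)].

Definition world_sig (sg : signature) : signature :=
  ([:: 3, sg.2.+1 & map S sg.1], 2).

Definition small (sg : signature) (psi : cq) : cq :=
  ground (world_sig sg).1 ++
  edge cstA cstB cstA :: edge cstA cstA cstB :: block cstA 0 sg.2 psi.

Definition big (m : nat) (psi : cq) (Q : ucq) : cq :=
  edge cstA cstB (stvar (size Q)) :: chain m psi Q.

Definition encode (x : signature * cq * ucq) : signature * cq * cq :=
  (world_sig x.1.1, small x.1.1 x.1.2, big x.1.1.2 x.1.2 x.2).

(** * Computability of the encoding *)

Section ComputableEncode.
Implicit Types G T U : countType.

Lemma computable_inl G T U (f : G -> T) :
  computable f -> computable (fun x => inl (f x) : T + U).
Proof.
(* A sum is coded as a pair of options, and an option as a list of length at most one. *)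
move=> Hf; apply: (@computable_pickle _ _ _ (fun x => ([:: f x], [::] : seq U))) => //.
apply: computable_pair; last exact: computable_cst.
by apply: computable_cons Hf (computable_cst _ _).
Qed.

Lemma computable_inr G T U (f : G -> T) :
  computable f -> computable (fun x => inr (f x) : U + T).
Proof.
move=> Hf; apply: (@computable_pickle _ _ _ (fun x => ([::] : seq U, [:: f x]))) => //.
apply: computable_pair; first exact: computable_cst.
by apply: computable_cons Hf (computable_cst _ _).
Qed.

Lemma computable_name G (k u : G -> nat) :
  computable k -> computable u -> computable (fun x => name (k x) (u x)).
Proof.
move=> Hk Hu; apply: computable_inl.
by apply: (computable_pickle (computable_pair Hk Hu)).
Qed.

Lemma computable_ren G (k : G -> nat) (t : G -> term) :
  computable k -> computable t -> computable (fun x => ren (k x) (t x)).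
Proof.
move=> Hk Ht; apply: computable_name Hk (computable_succ (computable_succ _)).
by apply: (computable_pickle Ht).
Qed.

Ltac computable := repeat match goal with
  | |- computable (fun _ => ?y) => exact: computable_cst
  | |- computable (fun x => x) => exact: computable_id
  | |- computable (fun x => (@?f x, @?g x)) => apply: computable_pair
  | |- computable (fun x => (@?f x).+1) => apply: computable_succ
  | |- computable (fun x => @?f x :: @?g x) => apply: computable_cons
  | |- computable (fun x => @?f x ++ @?g x) => apply: computable_cat
  | |- computable (fun x => name (@?f x) (@?g x)) => apply: computable_name
  | |- computable (fun x => ren (@?f x) (@?g x)) => apply: computable_ren
  | |- computable (fun x => map (@?f x) (@?g x)) => apply: computable_map
  | |- computable (fun x => nseq (@?f x) (@?g x)) => apply: computable_nseq
  | |- computable (fun x => iota 0 (@?f x)) => apply: computable_iota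
  | |- computable (fun x => inr (@?f x)) => apply: computable_inr
  | |- computable (fun x => (@?f x).1) => apply: computable_fst
  | |- computable (fun x => (@?f x).2) => apply: computable_snd
  | |- computable fst => apply: (computable_fst (computable_id _))
  | |- computable snd => apply: (computable_snd (computable_id _))
  | H : computable ?f |- computable ?f => exact: H
  | H : computable ?f |- computable (fun x => ?f (@?g x)) =>
      apply: (computable_comp H)
  end.

Lemma computable_block G (w : G -> term) (k m : G -> nat) (q : G -> cq) :
  computable w -> computable k -> computable m -> computable q ->
  computable (fun x => block (w x) (k x) (m x) (q x)).
Proof.
move=> Hw Hk Hm Hq; rewrite /block; computable.
Qed.

(** Carrying the number of disjuncts already treated replaces the calls to [size] and turns [chain]
    into a fold. *)
Definition chain_step (m : nat) (phi : cq) (p : nat * cq) : nat * cq :=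
  (p.1.+1, edge (stvar p.1.+1) (wvar p.1.+1) (stvar p.1) ::
             block (wvar p.1.+1) p.1.+1 m phi ++ p.2).

Lemma chain_foldr m psi Q :
  chain m psi Q = (foldr (chain_step m) (0, chain m psi [::]) Q).2.
Proof.
suff -> : foldr (chain_step m) (0, chain m psi [::]) Q =
          (size Q, chain m psi Q) by [].
by elim: Q => //= phi Q ->.
Qed.

Lemma computable_chain G (m : G -> nat) (psi : G -> cq) (Q : G -> ucq) :
  computable m -> computable psi -> computable Q ->
  computable (fun x => chain (m x) (psi x) (Q x)).
Proof.
move=> Hm Hpsi HQ; apply: computable_eq (_ : computable
  (fun x => (foldr (chain_step (m x)) (0, chain (m x) (psi x) [::]) (Q x)).2)) _;
  last by move=> x; rewrite -chain_foldr.
apply: computable_snd; apply: computable_foldr => //.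
  rewrite /chain_step /edge /stvar /wvar; computable.
  apply: computable_block; computable.
rewrite /edge /stvar /chain; computable; apply: computable_block; computable.
Qed.

Lemma computable_size G T (l : G -> seq T) :
  computable l -> computable (fun x => size (l x)).
Proof.
move=> Hl; apply: computable_eq (_ : computable
  (fun x => foldr (fun=> S) 0 (l x))) _; last by move=> x; elim: (l x) => //= a s ->.
by apply: (@computable_foldr _ _ _ (fun _ _ => S)); computable.
Qed.

Lemma computable_ground G (ars : G -> seq nat) :
  computable ars -> computable (fun x => ground (ars x)).
Proof.
(* Counting along the fold supplies the relation index, so no lookup by [nth] has to be
   programmed. *)
move=> Hars; pose next (p : nat * cq) n := (p.1.+1, (p.1, nseq n cstB) :: p.2).
apply: computable_eq (_ : computable
  (fun x => rev (foldl next (0, [::]) (ars x)).2)) _; last first.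
  move=> x; suff -> s : foldl next (0, [::]) s = (size s, rev (ground s)).
    by rewrite revK.
  elim/last_ind: s => [|s n IHs] //.
  rewrite foldl_rcons IHs /next /ground size_rcons -[(size s).+1]addn1 iotaD.
  rewrite map_cat rev_cat /= nth_rcons ltnn eqxx; congr (_, _ :: rev _).
  by apply/eq_in_map => i; rewrite mem_iota nth_rcons => /andP[_ ->].
apply: computable_rev; apply: computable_snd.
apply: (@computable_foldl _ _ _ (fun=> next)); rewrite /next; computable.
Qed.

Lemma computable_encode : computable encode.
Proof.
have Hx := computable_id (signature * cq * ucq)%type.
rewrite /encode /world_sig /small /big /edge /cstA /cstB /stvar; computable.
- apply: computable_ground; rewrite /world_sig; computable.
- apply: computable_block; computable.
- apply: computable_size; computable.
- apply: computable_chain; computable.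
Qed.

End ComputableEncode.

(** * Well-formedness of the encoding *)

Lemma wf_block sg w k q : wf_term (world_sig sg) w -> wf_cq sg q ->
  wf_cq (world_sig sg) (block w k sg.2 q).
Proof.
move=> ww /allP wq; rewrite /block /wf_cq /= {1}/wf_atom /= ww size_map size_iota.
rewrite eqxx /= all_map; apply/andP; split; first by apply/allP.
apply/allP => _ /mapP[a /wq /and3P[lt_a /eqP sz_a _] ->].
rewrite /wf_atom /= ww size_map !ltnS size_map lt_a (nth_map 0) // sz_a eqxx /=.
by rewrite all_map; apply/allP.
Qed.

Lemma wf_encode x : wf_cq_ucq x -> wf_cq_cq (encode x).
Proof.
case: x => [[sg psi] Q] /andP[/= wpsi wQ]; apply/andP; split.
  rewrite [_.2]/= /small /wf_cq all_cat; apply/andP; split;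
    last exact (@wf_block sg cstA 0 psi isT wpsi).
  apply/allP => a /mapP[i]; rewrite mem_iota => /andP[_ lt_i] -> {a}.
  by rewrite /wf_atom lt_i /= size_nseq eqxx /= all_nseq orbT.
rewrite [_.2]/= /big /wf_cq [all _ _]/=; elim: Q wQ => [|phi Q IHQ] /=.
  by move=> _; exact (@wf_block sg (stvar 0) 0 psi isT wpsi).
case/andP=> wphi wQ; rewrite -/(wf_cq _ _) /wf_cq all_cat.
rewrite (IHQ wQ) andbT; exact (@wf_block sg (wvar _) (size Q).+1 phi isT wphi).
Qed.

(** * Iterated sums over assignments *)

Section IteratedSums.
Variable V : finType.
Implicit Types (h g : nat -> option V) (vs ws : seq nat).
Implicit Types (F : (nat -> option V) -> nat).

Definition set_env h v x : nat -> option V := fun u => if u == v then Some x else h u.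

Definition no_env : nat -> option V := fun=> None.

(** Binding one variable at a time makes it easy to split, reorder and rename the summed variables,
    which finite functions on a fixed list do not. *)
Fixpoint isum vs F h : nat :=
  if vs is v :: vs' then \sum_x isum vs' F (set_env h v x) else F h.

Definition extends vs h g : Prop :=
  {in [predC vs], g =1 h} /\ {in vs, forall v, g v != None}.

Lemma extends_cons v vs h g x :
  v \notin vs -> extends vs (set_env h v x) g ->
  extends (v :: vs) h g /\ g v = Some x.
Proof.
move=> nv [g1 g2]; have gv : g v = Some x by rewrite g1 // /set_env eqxx.
split=> //; split=> u; rewrite !inE; last by case/predU1P=> [->|/g2 //]; rewrite gv.
by case/norP=> uv nu; rewrite g1 ?inE // /set_env (negbTE uv).
Qed.

Lemma extends_cons_weak v vs h g x :
  extends vs (set_env h v x) g -> extends (v :: vs) h g.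
Proof.
move=> [g1 g2]; split=> u; rewrite !inE.
  by case/norP=> uv nu; rewrite g1 ?inE // /set_env (negbTE uv).
case/predU1P=> [->|/g2 //]; have [/g2 //|nv] := boolP (v \in vs).
by rewrite g1 // /set_env eqxx.
Qed.

Lemma leq_isum vs F1 F2 h :
  (forall g, extends vs h g -> F1 g <= F2 g) -> isum vs F1 h <= isum vs F2 h.
Proof.
elim: vs h => [|v vs IHvs] h le_F /=; first by apply: le_F; split.
by apply: leq_sum => x _; apply: IHvs => g /extends_cons_weak; apply: le_F.
Qed.

Lemma eq_isum vs F1 F2 h :
  (forall g, extends vs h g -> F1 g = F2 g) -> isum vs F1 h = isum vs F2 h.
Proof.
by move=> eqF; apply/eqP; rewrite eqn_leq !leq_isum // => g /eqF ->.
Qed.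

Lemma isum_cat vs ws F h : isum (vs ++ ws) F h = isum vs (isum ws F) h.
Proof. by elim: vs h => //= v vs IHvs h; apply: eq_bigr => x _. Qed.

Lemma isum_mull vs F c h : isum vs (fun g => c * F g) h = c * isum vs F h.
Proof.
by elim: vs h => //= v vs IHvs h; rewrite big_distrr; apply: eq_bigr => x _.
Qed.

Lemma isum_add vs F1 F2 h :
  isum vs (fun g => F1 g + F2 g) h = isum vs F1 h + isum vs F2 h.
Proof.
by elim: vs h => //= v vs IHvs h; rewrite -big_split; apply: eq_bigr => x _.
Qed.

Lemma isum0 vs h : isum vs (fun=> 0) h = 0.
Proof. by rewrite -[RHS](mul0n (isum vs (fun=> 0) h)) -isum_mull. Qed.

Definition local (U : pred nat) F := forall h g, {in U, h =1 g} -> F h = F g.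

Lemma isum_local U vs F h g : local U F ->
  {in U, forall u, u \notin vs -> h u = g u} -> isum vs F h = isum vs F g.
Proof.
move=> locF; elim: vs h g => [|v vs IHvs] h g hg /=.
  by apply: locF => u Uu; apply: hg.
apply: eq_bigr => x _; apply: IHvs => u Uu nu; rewrite /set_env.
by case: eqP => // /eqP uv; apply: hg; rewrite // inE negb_or uv.
Qed.

Lemma set_envC h v w x y : v != w ->
  set_env (set_env h v x) w y = set_env (set_env h w y) v x.
Proof.
move=> vw; apply: functional_extensionality => u; rewrite /set_env.
by case: eqP => // ->; rewrite eq_sym (negbTE vw).
Qed.

Lemma isum_move v vs ws F h : v \notin vs ->
  isum (vs ++ v :: ws) F h = isum (v :: vs ++ ws) F h.
Proof.
elim: vs h => //= u vs IHvs h; rewrite inE negb_or => /andP[vu nv].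
under eq_bigr => x _ do rewrite IHvs //=.
rewrite exchange_big; apply: eq_bigr => x _; apply: eq_bigr => y _.
by rewrite set_envC // eq_sym.
Qed.

Lemma isum_perm vs ws F h : uniq vs -> perm_eq vs ws ->
  isum vs F h = isum ws F h.
Proof.
elim: vs ws h => [|v vs IHvs] ws h; first by rewrite perm_sym => _ /perm_nilP ->.
case/andP=> nv uvs pvs; have uws : uniq ws by rewrite -(perm_uniq pvs) /= nv.
have v_ws : v \in ws by rewrite -(perm_mem pvs) mem_head.
case/splitPr: v_ws pvs uws => s1 s2.
rewrite -[v :: s2]cat1s perm_sym perm_catCA /= perm_cons perm_sym => pvs.
rewrite cat_uniq /= negb_or => /and3P[_ /andP[nv1 _] _].
by rewrite isum_move //=; apply: eq_bigr => x _; apply: IHvs.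
Qed.

Lemma isum_map (f : nat -> nat) vs F h : injective f ->
  isum (map f vs) (fun g => F (g \o f)) h = isum vs F (h \o f).
Proof.
move=> injf; elim: vs h => //= v vs IHvs h; apply: eq_bigr => x _; rewrite IHvs.
congr isum; apply: functional_extensionality => u.
by rewrite /set_env /= (inj_eq injf).
Qed.

Definition assign (p : nat -> V) vs h : nat -> option V :=
  fun u => if u \in vs then Some (p u) else h u.

Lemma assign_cons p v vs h :
  assign p vs (set_env h v (p v)) = assign p (v :: vs) h.
Proof.
apply: functional_extensionality => u; rewrite /assign /set_env inE.
by case: eqP => [->|_] /=; case: ifP.
Qed.

Lemma isum_ge p vs F h : F (assign p vs h) <= isum vs F h.
Proof.
elim: vs h => [|v vs IHvs] h //=; rewrite -assign_cons.
by apply: leq_trans (IHvs _) _; rewrite (bigD1 (p v)) //= leq_addr.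
Qed.

(** Meant for the canonical structure, whose facts often leave a single possible value for each
    variable. *)
Lemma isum_point p vs F h : uniq vs ->
  (forall g, extends vs h g -> F g != 0 -> {in vs, forall v, g v = Some (p v)}) ->
  isum vs F h = F (assign p vs h).
Proof.
elim: vs h => [|v vs IHvs] h //= /andP[nv uvs] Fp.
rewrite (bigD1 (p v)) //= big1 ?addn0 => [|x xp].
  rewrite IHvs // ?assign_cons // => g /(extends_cons nv)[eg _] Fg u vu.
  by apply: (Fp g eg Fg u); rewrite inE vu orbT.
rewrite -[RHS](isum0 vs (set_env h v x)); apply: eq_isum => g.
case/(extends_cons nv) => eg gv; apply/eqP; apply: contraNT xp => Fg.
by have := Fp g eg Fg v (mem_head _ _); rewrite gv => -[->].
Qed.

Definition lookup vs (f : {ffun 'I_(size vs) -> V}) h : nat -> option V :=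
  fun v => if insub (index v vs) is Some i then Some (f i) else h v.

Lemma isum_ffun vs F h : uniq vs ->
  \sum_(f : {ffun 'I_(size vs) -> V}) F (lookup f h) = isum vs F h.
Proof.
elim: vs h => [|v vs IHvs] h.
  move=> _; rewrite (big_pred1 (ffun0 (card_ord 0))); last first.
    by move=> f; apply/esym/eqP/ffunP => -[].
  congr F; apply: functional_extensionality => u.
  by rewrite /lookup; case: insubP.
case/andP=> nv uvs /=.
(* A finite function is its value at index 0, for the head variable, together with its restriction
   to the other indices. *)
pose split (f : {ffun 'I_(size vs).+1 -> V}) :=
  (f ord0, [ffun i => f (lift ord0 i)] : {ffun 'I_(size vs) -> V}).
pose glue (p : V * {ffun 'I_(size vs) -> V}) : {ffun 'I_(size vs).+1 -> V} :=
  [ffun i => if unlift ord0 i is Some j then p.2 j else p.1].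
have glueK : cancel glue split.
  move=> [x f]; rewrite /split ffunE unlift_none /=; congr (_, _).
  by apply/ffunP => i; rewrite !ffunE liftK.
have splitK : cancel split glue.
  by move=> f; apply/ffunP => i; rewrite ffunE; case: unliftP => [j|] ->; rewrite ?ffunE.
rewrite (reindex glue) /=; last by exists split => ? _.
rewrite -(pair_bigA _ (fun x f => F (@lookup (v :: vs) (glue (x, f)) h))) /=.
apply: eq_bigr => x _; rewrite -(IHvs _ uvs); apply: eq_bigr => f _; congr F.
apply: functional_extensionality => u; rewrite /lookup /set_env /= eq_sym.
case: eqP => [->|_].
  rewrite memNindex // [in RHS]insubF ?ltnn //.
  case: insubP => [i _ /= i0|//]; have -> : i = ord0 by apply: val_inj.
  by rewrite ffunE unlift_none.
case: (insubP _ (index u vs)) => [i _ ei|/= nlt]; last by rewrite insubF // ltnS (negbTE nlt).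
case: insubP => [j _ ej|]; last by rewrite -ei /= ltnS ltn_ord.
have -> : j = lift ord0 i by apply: val_inj; rewrite /= [LHS]ej -ei.
by rewrite ffunE liftK.
Qed.

End IteratedSums.

(** * Counting homomorphisms of the encoded queries *)

Section Valuations.
Variables (sg : signature) (D : structure sg).
Implicit Types (h g : nat -> option 'I_(sz D)) (q : cq).

Definition ev h (t : term) : option 'I_(sz D) :=
  match t with
  | inl v => h v
  | inr c => omap (@cst sg D) (insub c)
  end.

Definition sat h (a : atom) : bool :=
  let ts := map (ev h) a.2 in
  all (fun o => o != None) ts && @rels sg D a.1 (pmap id ts).

Definition holds h q : bool := all (sat h) q.

(** Along [lookup], [ev] computes to [eval_term], so only the form of the sum changes. *)
Lemma cq_countE q :
  cq_count D q = isum (cq_vars q) (fun h => holds h q : nat) (@no_env _).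
Proof.
by rewrite -isum_ffun ?undup_uniq //; apply: eq_bigr.
Qed.

Lemma mem_cq_vars q v : (v \in cq_vars q) = has (fun a => inl v \in a.2) q.
Proof.
rewrite mem_undup; apply/flatten_mapP/hasP => -[a qa].
  by case/flatten_mapP => -[u|c] ta; rewrite ?inE // => /eqP ->; exists a.
by move=> va; exists a => //; apply/flatten_mapP; exists (inl v); rewrite ?inE.
Qed.

Lemma holds_local q : local [pred v in cq_vars q] (fun h => holds h q : nat).
Proof.
move=> h g hg; congr (nat_of_bool _); apply: eq_in_all => a qa; rewrite /sat.
suff -> : map (ev h) a.2 = map (ev g) a.2 by [].
apply/eq_in_map => -[v|c] //= va; apply: hg; rewrite inE mem_cq_vars.
by apply/hasP; exists a.
Qed.

End Valuations.

(** * Counts of blocks and chains *)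

Section Worlds.
Variables (sg : signature) (D : structure (world_sig sg)).
Notation V := 'I_(sz D).
Notation m := sg.2.
Implicit Types (h g : nat -> option V) (q : cq) (Q : ucq) (x : V).

Definition cA : V := @cst _ D (@Ordinal 2 0 isT).
Definition cB : V := @cst _ D (@Ordinal 2 1 isT).

Lemma ev_cstA h : ev h cstA = Some cA.
Proof. by rewrite /= insubT /=; congr (Some (cst _ _)); apply: val_inj. Qed.

Lemma ev_cstB h : ev h cstB = Some cB.
Proof. by rewrite /= insubT /=; congr (Some (cst _ _)); apply: val_inj. Qed.

(* The structure seen in world [x] when the constants are read off [g]. *)
Definition world x g : structure sg :=
  @Structure sg (sz D) (fun i t => @rels _ D i.+2 (x :: t))
    (fun c => odflt x (g c)).

(** The contribution of one [block] in world [x]: the outer sum runs over the tuples that [W] admits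
    as old constants. *)
Definition wcount x q : nat :=
  isum (iota 0 m) (fun g =>
    (@rels _ D 1 (x :: pmap g (iota 0 m)) : nat) * cq_count (world x g) q)
    (@no_env _).

Definition var_id (k u : nat) : nat := pickle (k, u).
Definition cvar k (c : nat) := var_id k (pickle (inr c : term)).+2.
Definition vvar k (v : nat) := var_id k (pickle (inl v : term)).+2.

(** Variables for constants come first, matching the nesting of the sums in [wcount]. *)
Definition bvars k q : seq nat := map (cvar k) (iota 0 m) ++ map (vvar k) (cq_vars q).

Lemma var_id_inj k u k' u' : var_id k u = var_id k' u' -> k = k' /\ u = u'.
Proof. by move/(pcan_inj pickleK) => [-> ->]. Qed.

Lemma var_id_term_inj k (t t' : term) k' :
  var_id k (pickle t).+2 = var_id k' (pickle t').+2 -> t = t'.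
Proof. by move=> /var_id_inj[_ /succn_inj/succn_inj]; apply: (pcan_inj pickleK). Qed.

Lemma cvar_inj k : injective (cvar k).
Proof. by move=> c c' /var_id_term_inj[]. Qed.

Lemma vvar_inj k : injective (vvar k).
Proof. by move=> v v' /var_id_term_inj[]. Qed.

Lemma cvar_vvar k c v : cvar k c != vvar k v.
Proof. by apply/eqP => /var_id_term_inj. Qed.

Lemma uniq_bvars k q : uniq (bvars k q).
Proof.
rewrite cat_uniq !map_inj_uniq ?iota_uniq ?undup_uniq; first last.
- exact: cvar_inj.
- exact: vvar_inj.
rewrite andbT /=; apply/hasPn => _ /mapP[v _ ->]; apply/negP => /mapP[c _ /eqP].
by rewrite eq_sym (negbTE (cvar_vvar _ _ _)).
Qed.

Lemma holds_block h k q w x : wf_cq sg q -> ev h w = Some x ->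
  {in iota 0 m, forall c, h (cvar k c) != None} ->
  holds h (block w k m q) =
  @rels _ D 1 (x :: pmap (h \o cvar k) (iota 0 m)) &&
  @holds _ (world x (h \o cvar k)) (h \o vvar k) q.
Proof.
move=> /allP wq hw hc; rewrite /holds /= {1}/sat /= hw /= -map_comp; congr andb.
  rewrite (_ : all _ _ = true) /=; last by rewrite all_map; apply/allP => c /hc.
  by congr (rels _ (x :: _)); elim: (iota 0 m) => //= c s ->.
rewrite all_map; apply: eq_in_all => a qa; rewrite /sat /= hw -map_comp /=.
set s1 := map _ a.2; set s2 := map _ a.2; suff -> : s1 = s2 by [].
apply/eq_in_map => -[v|c] // ta /=.
have /and3P[_ _ /allP/(_ _ ta)/= ltc] := wq a qa.
rewrite insubT /=; have := hc c; rewrite mem_iota => /(_ ltc) /=.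
by rewrite -[pickle (k, _)]/(cvar k c); case: (h _).
Qed.

Lemma wcount_local x q : local [pred c | c < m]
  (fun g => (@rels _ D 1 (x :: pmap g (iota 0 m)) : nat) * cq_count (world x g) q).
Proof.
move=> h g hg; have -> : pmap h (iota 0 m) = pmap g (iota 0 m).
  have: {subset iota 0 m <= [pred c | c < m]} by move=> c; rewrite mem_iota.
  by elim: (iota 0 m) => //= c s IHs sub; rewrite IHs ?hg ?sub ?mem_head // => u su;
     rewrite sub // inE su orbT.
congr (_ * cq_count _ _); congr Structure; apply: functional_extensionality => c.
by rewrite hg // inE.
Qed.

(** By [holds_block] the summand is the [W] factor times the truth of [q] in [world x]. The former
    is constant in the inner sum, since names of constants and of variables differ. *)
Lemma isum_block h k q w x : wf_cq sg q ->
  (forall g, extends (bvars k q) h g -> ev g w = Some x) ->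
  isum (bvars k q) (fun g => holds g (block w k m q) : nat) h = wcount x q.
Proof.
move=> wq gw; pose R g : nat := @rels _ D 1 (x :: pmap g (iota 0 m)).
pose G g := R g * cq_count (world x g) q.
pose F gc (gv : nat -> option V) : nat := @holds _ (world x gc) gv q.
transitivity (isum (bvars k q) (fun g => R (g \o cvar k) * F (g \o cvar k) (g \o vvar k)) h).
  apply: eq_isum => g eg; rewrite (holds_block wq (gw g eg)) /R /F ?mulnb //.
  by move=> c mc; apply: (proj2 eg); rewrite mem_cat map_f.
rewrite isum_cat; transitivity (isum (map (cvar k) (iota 0 m))
    (fun g => G (g \o cvar k)) h).
  apply: eq_isum => g _; transitivity (isum (map (vvar k) (cq_vars q))
    (fun g' => R (g \o cvar k) * F (g \o cvar k) (g' \o vvar k)) g).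
    apply: eq_isum => g' [eg _]; suff -> : g' \o cvar k = g \o cvar k by [].
    apply: functional_extensionality => c; apply: eg; rewrite inE.
    by apply/mapP => -[v _ /eqP]; rewrite (negbTE (cvar_vvar _ _ _)).
  rewrite isum_mull /G (isum_map _ _ _ (@vvar_inj k)) cq_countE; congr (_ * _).
  apply: (isum_local (@holds_local _ (world x (g \o cvar k)) q)) => v.
  by rewrite inE => ->.
rewrite (isum_map _ G _ (@cvar_inj k)).
by apply: (isum_local (@wcount_local x q)) => c; rewrite inE mem_iota => ->.
Qed.

(** Constants of a well-formed [q] lie below [m], so their variables all occur in the [W] atom. *)
Lemma has_block v w k q : wf_cq sg q ->
  has (fun a : atom => inl v \in a.2) (block w k m q) =
  (inl v == w) || (v \in bvars k q).
Proof.
move=> /allP wq; apply/idP/idP.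
  rewrite /block /= inE has_map -orbA; case/or3P=> [->//|/mapP[c mc [->]]|].
    by apply/orP; right; rewrite mem_cat; apply/orP; left; apply: (map_f (cvar k)).
  case/hasP=> a qa /=; rewrite inE => /orP[->//|/mapP[t ta [->]]].
  have /and3P[_ _ /allP/(_ _ ta)] := wq a qa; case: t ta => [u|c] ta /= ltc.
    apply/orP; right; rewrite mem_cat; apply/orP; right.
    by apply: (map_f (vvar k)); rewrite mem_cq_vars; apply/hasP; exists a.
  apply/orP; right; rewrite mem_cat; apply/orP; left.
  by apply: (map_f (cvar k)); rewrite mem_iota.
case/orP=> [vw|]; first by rewrite /= inE vw.
rewrite mem_cat => /orP[] /mapP[u Hu ->] /=.
  by apply/orP; left; rewrite inE; apply/orP; right; apply: (map_f (fun c => ren k (inr c))).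
rewrite has_map; move: Hu; rewrite mem_cq_vars => /hasP[a qa ua].
apply/orP; right; apply/hasP; exists a => //=.
by rewrite inE; apply/orP; right; apply: (map_f (ren k) ua).
Qed.

Lemma mem_bvars u k q : u \in bvars k q -> exists j, u = var_id k j.+2.
Proof. by rewrite mem_cat => /orP[] /mapP[v _ ->]; eexists. Qed.

(** The initial state [var_id (size Q) 0] is left out: it is shared with the preceding edge and
    bound there. *)
Fixpoint cvars psi Q : seq nat :=
  if Q is phi :: Q' then
    let k := (size Q').+1 in
    [:: var_id k 1, var_id (size Q') 0 & bvars k phi ++ cvars psi Q']
  else bvars 0 psi.

(** Bounds the link indices in a chain, which separates its names from those of earlier links. *)
Lemma mem_cvars psi Q u : u \in cvars psi Q ->
  exists k j, u = var_id k j /\ (k < size Q \/ k = size Q /\ 0 < j).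
Proof.
elim: Q => [|phi Q IHQ] /=.
  by case/mem_bvars=> j ->; exists 0, j.+2; split=> //; right.
rewrite !inE mem_cat; case/or4P=> [/eqP->|/eqP->|/mem_bvars[j ->]|/IHQ[k [j [-> kj]]]].
- by exists (size Q).+1, 1; split=> //; right.
- by exists (size Q), 0; split=> //; left.
- by exists (size Q).+1, j.+2; split=> //; right.
- by exists k, j; split=> //; left; case: kj => [/leqW//|[->]].
Qed.

Lemma var_id_notin_cvars psi Q k j : size Q < k -> var_id k j \notin cvars psi Q.
Proof.
move=> ltk; apply/negP => /mem_cvars[k' [j' [/var_id_inj[<- _] []]]].
  by rewrite ltnNge ltnW.
by case=> ek _; rewrite ek ltnn in ltk.
Qed.

Lemma var_id_notin_bvars k j k' q : k != k' \/ j < 2 -> var_id k j \notin bvars k' q.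
Proof.
move=> H; apply/negP => /mem_bvars[j' /var_id_inj[ek ej]]; subst.
by case: H => //; rewrite eqxx.
Qed.

Lemma uniq_cvars psi Q : uniq (var_id (size Q) 0 :: cvars psi Q).
Proof.
elim: Q => [|phi Q IHQ] /=; first by rewrite var_id_notin_bvars ?uniq_bvars //; right.
have var_idE k j k' j' : (var_id k j == var_id k' j') = (k == k') && (j == j').
  apply/eqP/andP => [/var_id_inj[-> ->] //|[/eqP-> /eqP-> //]].
move: IHQ; rewrite cons_uniq => /andP[n0 uQ].
rewrite !inE !(mem_cat _ (bvars _ _)) !negb_or !var_idE !eqxx /= eqn_leq ltnn /=.
rewrite n0 !var_id_notin_cvars ?ltnSn // !var_id_notin_bvars /=;
  try by [right|left; rewrite eqn_leq ltnn andbF].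
rewrite cat_uniq uniq_bvars uQ andbT; apply/hasPn => u uQ'.
apply: contraL uQ' => /mem_bvars[j ->]; exact: var_id_notin_cvars.
Qed.

Lemma has_chain psi Q v : wf_cq sg psi -> wf_ucq sg Q ->
  has (fun a : atom => inl v \in a.2) (chain m psi Q) =
  (v \in var_id (size Q) 0 :: cvars psi Q).
Proof.
have inlE u u' : (inl u == inl u' :> term) = (u == u') by [].
move=> wpsi; elim: Q => [|phi Q IHQ] wQ.
  rewrite -[has _ _]/((inl v \in (edge (stvar 0) (stvar 0) (stvar 0)).2) ||
    has _ (block (stvar 0) 0 m psi)) has_block // !inE !inlE.
  by case: (v == _); rewrite //= orbT.
have /andP[wphi wQ'] := wQ.
pose k := (size Q).+1.
rewrite -[has _ _]/((inl v \in (edge (stvar k) (wvar k) (stvar (size Q))).2) ||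
  has _ (block (wvar k) k m phi ++ chain m psi Q)) has_cat has_block // (IHQ wQ').
rewrite -[cvars _ (_ :: _)]/([:: var_id k 1, var_id (size Q) 0 & bvars k phi ++ cvars psi Q]).
rewrite !inE (mem_cat _ (bvars _ _)) !inlE.
rewrite -[pickle (k, 0)]/(var_id k 0) -[pickle (k, 1)]/(var_id k 1).
rewrite -[pickle (size Q, 0)]/(var_id (size Q) 0) -[size (phi :: Q)]/k.
move: (v == var_id k 0) (v == var_id k 1) (v == var_id (size Q) 0).
move: (v \in bvars k phi) (v \in cvars psi Q).
by do 5 case.
Qed.

Definition ccount psi Q v : nat :=
  isum (cvars psi Q) (fun g => holds g (chain m psi Q) : nat)
    (set_env (@no_env _) (var_id (size Q) 0) v).

Lemma sat_edge g (s w t : term) x y z : ev g s = Some x -> ev g w = Some y ->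
  ev g t = Some z -> sat g (edge s w t) = @rels _ D 0 [:: x; y; z].
Proof. by rewrite /sat /= => -> -> ->. Qed.

Lemma ccount_nil psi v : wf_cq sg psi ->
  ccount psi [::] v = (@rels _ D 0 [:: v; v; v] : nat) * wcount v psi.
Proof.
move=> wpsi; rewrite /ccount /=; set h := set_env _ _ _.
have gv g : extends (bvars 0 psi) h g -> ev g (stvar 0) = Some v.
  move=> [eg _]; have n0 : var_id 0 0 \notin bvars 0 psi by apply: var_id_notin_bvars; right.
  by rewrite /= eg ?inE // /h /set_env eqxx.
rewrite -(isum_block wpsi gv) -isum_mull; apply: eq_isum => g /gv eg.
by rewrite (sat_edge eg eg eg) mulnb.
Qed.

(** A transfer-matrix recursion: once the world [x] and the next state [y] are fixed, the block of
    [phi] and the remaining chain share no summed variable, so their counts multiply. *)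
Lemma ccount_cons psi phi Q v : wf_cq sg psi -> wf_cq sg phi -> wf_ucq sg Q ->
  ccount psi (phi :: Q) v =
  \sum_x \sum_y (@rels _ D 0 [:: v; x; y] : nat) * (wcount x phi * ccount psi Q y).
Proof.
move=> wpsi wphi wQ; rewrite /ccount /=.
have := uniq_cvars psi (phi :: Q).
rewrite [cvars _ _]/= [size _]/=; set k := (size Q).+1; set vs := _ ++ _.
rewrite !cons_uniq !inE !negb_or.
case/and4P=> /and3P[n01 n00 n0v] /andP[n10 n1v] nv.
rewrite cat_uniq => /and3P[_ disj uQ].
apply: eq_bigr => x _; apply: eq_bigr => y _.
set h := set_env _ (var_id (size Q) 0) y.
have [h0 h1 hy] : [/\ h (var_id k 0) = Some v, h (var_id k 1) = Some x &
  h (var_id (size Q) 0) = Some y].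
  by rewrite /h /set_env !eqxx (negbTE n01) (negbTE n00) (negbTE n10).
transitivity (isum vs (fun g => (@rels _ D 0 [:: v; x; y] : nat) *
    (holds g (block (wvar k) k m phi) * holds g (chain m psi Q))) h).
  apply: eq_isum => g [eg _]; rewrite /holds !mulnb -all_cat.
  rewrite -(@sat_edge g (stvar k) (wvar k) (stvar (size Q)) v x y) //.
  - by rewrite -h0; apply: eg; rewrite inE.
  - by rewrite -h1; apply: eg; rewrite inE.
  - by rewrite -hy; apply: eg; rewrite inE.
rewrite isum_mull isum_cat; congr (_ * _).
have gx g : extends (bvars k phi) h g -> ev g (wvar k) = Some x.
  move=> [eg _]; rewrite -h1; apply: eg; rewrite inE var_id_notin_bvars //.
  by right.
rewrite -(isum_block wphi gx) mulnC -isum_mull; apply: eq_isum => g eg.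
rewrite mulnC.
(* No variable of the block is summed here, so its truth value can be read at [g] and factored
   out. *)
transitivity (isum (cvars psi Q) (fun g' => (holds g (block (wvar k) k m phi) : nat) *
   (holds g' (chain m psi Q) : nat)) g).
  apply: eq_isum => g' [eg' _]; congr (_ * _); apply: holds_local => u.
  rewrite inE mem_cq_vars has_block // => uB; apply: eg'; rewrite inE.
  case/orP: uB => [/eqP[->]|uB]; first exact: var_id_notin_cvars.
  by apply: contraNN disj => uQ'; apply/hasP; exists u.
rewrite isum_mull; congr (_ * _).
apply: (isum_local (@holds_local _ _ (chain m psi Q))) => u.
rewrite inE mem_cq_vars has_chain // inE => /predU1P[-> _|-> //].
rewrite {1}/set_env eqxx -hy; apply: (proj1 eg).
by rewrite inE var_id_notin_bvars //; left; rewrite eqn_leq ltnn andbF.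
Qed.

Lemma cq_count_big psi Q : wf_cq sg psi -> wf_ucq sg Q ->
  cq_count D (big m psi Q) =
  \sum_v (@rels _ D 0 [:: cA; cB; v] : nat) * ccount psi Q v.
Proof.
move=> wpsi wQ; rewrite cq_countE.
(* The summation is reordered so that the initial state is bound first. *)
rewrite (@isum_perm _ _ (var_id (size Q) 0 :: cvars psi Q)) ?undup_uniq //; last first.
  apply: uniq_perm; rewrite ?undup_uniq ?uniq_cvars // => u.
  rewrite mem_cq_vars -[has _ _]/((inl u \in (edge cstA cstB (stvar (size Q))).2) ||
    has _ (chain m psi Q)) has_chain // !inE.
  rewrite -[inl u == cstA]/false -[inl u == cstB]/false.
  by rewrite -[inl u == stvar _]/(u == var_id (size Q) 0) orbA orbb.
apply: eq_bigr => v _; rewrite /ccount -isum_mull; apply: eq_isum => g [eg _].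
rewrite /holds /= (@sat_edge g _ _ _ cA cB v) ?ev_cstA ?ev_cstB ?mulnb //=.
have := uniq_cvars psi Q; rewrite cons_uniq => /andP[n0 _].
by rewrite eg ?inE // /set_env eqxx.
Qed.

Lemma holds_ground g ars : holds g (ground ars) =
  all (fun i => @rels _ D i (nseq (nth 0 ars i) cB)) (iota 0 (size ars)).
Proof.
rewrite /holds all_map; apply: eq_all => i; rewrite /sat /= map_nseq ev_cstB.
by rewrite all_nseq orbT /=; congr rels; elim: (nth _ _ _) => //= n ->.
Qed.

(** The atoms outside the block contain no variables and give a factor 0 or 1. *)
Lemma cq_count_small psi : wf_cq sg psi ->
  cq_count D (small sg psi) =
  [&& all (fun i => @rels _ D i (nseq (nth 0 (world_sig sg).1 i) cB))
        (iota 0 (size (world_sig sg).1)),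
      @rels _ D 0 [:: cA; cB; cA] & @rels _ D 0 [:: cA; cA; cB]] * wcount cA psi.
Proof.
move=> wpsi; rewrite cq_countE.
rewrite (@isum_perm _ _ (bvars 0 psi)) ?undup_uniq //; last first.
  apply: uniq_perm; rewrite ?undup_uniq ?uniq_bvars // => u.
  rewrite mem_cq_vars has_cat -[X in _ || X]/(has _ (block cstA 0 m psi)) has_block //.
  rewrite (_ : has _ (ground _) = false) //; apply/hasPn => a /mapP[i _ -> /=].
  by rewrite mem_nseq andbF.
have ga g : extends (bvars 0 psi) (@no_env _) g -> ev g cstA = Some cA.
  by rewrite ev_cstA.
rewrite -(isum_block wpsi ga) -isum_mull; apply: eq_isum => g _.
rewrite /holds all_cat -[all _ (ground _)]/(holds g _) holds_ground.
rewrite [X in _ && X]/= (@sat_edge g _ _ _ cA cB cA) ?ev_cstA ?ev_cstB //.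
rewrite (@sat_edge g _ _ _ cA cA cB) ?ev_cstA ?ev_cstB // mulnb.
by rewrite !andbA.
Qed.

End Worlds.

(** * The encoding preserves containment *)

(** With the choice of old constants outermost, all disjuncts are counted in the same [world x g],
    where the assumed containment applies. *)
Lemma wcount_sum sg (D : structure (world_sig sg)) x Q :
  sumn (map (@wcount sg D x) Q) =
  isum (iota 0 sg.2) (fun g =>
    (@rels _ D 1 (x :: pmap g (iota 0 sg.2)) : nat) * ucq_count (world x g) Q)
    (@no_env _).
Proof.
elim: Q => [|phi Q IHQ] /=.
  apply/esym; transitivity (isum (iota 0 sg.2) (fun=> 0) (@no_env 'I_(sz D))).
    by apply: eq_isum => g _; rewrite muln0.
  exact: isum0.
rewrite IHQ /wcount -isum_add; apply: eq_isum => g _.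
by rewrite /ucq_count /= mulnDr.
Qed.

Lemma leq_sum2 (V : finType) (F : V -> V -> nat) x0 y0 :
  F x0 y0 <= \sum_x \sum_y F x y.
Proof.
by rewrite (bigD1 x0) //= (bigD1 y0) //= -addnA leq_addr.
Qed.

Lemma sum2_pick (V : finType) (F : V -> V -> nat) x0 y0 :
  \sum_x \sum_y ((x == x0) && (y == y0) : nat) * F x y = F x0 y0.
Proof.
rewrite (bigD1 x0) //= (bigD1 y0) //= !eqxx mul1n !big1 ?addn0 // => x /negbTE ne.
  by rewrite big1 // => y _; rewrite ne mul0n.
by rewrite ne mul0n.
Qed.

Section Soundness.
Variables (sg : signature) (D : structure (world_sig sg)).
Notation m := sg.2.
Notation a := (cA D).
Notation b := (cB D).

Hypothesis groundB : {in iota 0 (size (world_sig sg).1), forall i,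
  @rels _ D i (nseq (nth 0 (world_sig sg).1 i) b)}.

(** Sending every variable and every old constant to [b] satisfies all atoms by [groundB]. *)
Lemma wcountB_gt0 q : wf_cq sg q -> 0 < wcount b q.
Proof.
move=> /allP wq; apply: leq_trans (isum_ge (fun=> b) _ _ _).
set g := assign _ _ _; have gE c : c < m -> g c = Some b.
  by move=> ltc; rewrite /g /assign mem_iota ltc.
have -> : pmap g (iota 0 m) = nseq m b.
  have: {subset iota 0 m <= [pred c | c < m]} by move=> c; rewrite mem_iota.
  rewrite -[X in nseq X](size_iota 0 m).
  elim: (iota 0 m) => //= c s IHs sub; rewrite gE ?IHs //=; last exact/sub/mem_head.
  by move=> u us; apply: sub; rewrite inE us orbT.
have /= -> := groundB (isT : 1 \in iota 0 (size (world_sig sg).1)); rewrite mul1n.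
rewrite cq_countE; apply: leq_trans (isum_ge (fun=> b) _ _ _).
set h := assign _ _ _; rewrite lt0b; apply/allP => atm qa.
have /and3P[lt_a /eqP sz_a /allP wt] := wq _ qa; rewrite /sat.
have -> : map (@ev _ (world b g) h) atm.2 = nseq (size atm.2) (Some b).
  rewrite -[in RHS](size_map (@ev _ (world b g) h)); apply/all_pred1P.
  rewrite all_map; apply/allP => -[v|c] ta /=.
    rewrite /h /assign mem_cq_vars; case: hasP => // -[]; by exists atm.
  have ltc : c < m by apply: wt ta.
  by rewrite insubT /= gE.
rewrite all_nseq orbT /= sz_a.
have := groundB (x := atm.1.+2); rewrite mem_iota /= size_map !ltnS.
rewrite (nth_map 0) // => /(_ lt_a) /=.
by congr (rels _ (_ :: _)); elim: (nth _ _ _) => //= n ->.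
Qed.

Lemma ccountB_gt0 psi Q : wf_cq sg psi -> wf_ucq sg Q -> 0 < ccount psi Q b.
Proof.
have eB := groundB (isT : 0 \in iota 0 (size (world_sig sg).1)).
move=> wpsi; elim: Q => [|phi Q IHQ] wQ.
  by rewrite ccount_nil // eB mul1n wcountB_gt0.
case/andP: wQ => wphi wQ; rewrite ccount_cons //.
apply: leq_trans (leq_sum2 _ b b); rewrite eB mul1n muln_gt0.
by rewrite wcountB_gt0 // IHQ.
Qed.

(** At state [a], the edge [E(a,a,b)] counts [phi] in world [a] and continues from [b], while
    [E(a,b,a)] defers the choice to the tail. Since [a != b] these are different summands, and every
    factor taken at [b] is at least 1. *)
Lemma ccount_ge psi Q : wf_cq sg psi -> wf_ucq sg Q ->
  @rels _ D 0 [:: a; b; a] -> @rels _ D 0 [:: a; a; b] -> a != b ->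
  sumn (map (wcount a) Q) <= ccount psi Q a.
Proof.
move=> wpsi wQ eba eab neq; elim: Q wQ => //= phi Q IHQ /andP[wphi wQ].
rewrite ccount_cons // (bigD1 a) //=; apply: leq_add.
  rewrite (bigD1 b) //= eab mul1n; apply: leq_trans (leq_addr _ _).
  by rewrite leq_pmulr // ccountB_gt0.
rewrite (bigD1 b) 1?eq_sym //=; apply: leq_trans (leq_addr _ _).
rewrite (bigD1 a) //= eba mul1n; apply: leq_trans (leq_addr _ _).
by apply: leq_trans (IHQ wQ) _; rewrite leq_pmull // wcountB_gt0.
Qed.

(** The path constant at [b] ends in the block of [psi], and its other factors are at least 1. *)
Lemma ccount_ge_collapsed psi Q : wf_cq sg psi -> wf_ucq sg Q ->
  wcount b psi <= ccount psi Q b.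
Proof.
have eB := groundB (isT : 0 \in iota 0 (size (world_sig sg).1)).
move=> wpsi; elim: Q => [|phi Q IHQ] wQ; first by rewrite ccount_nil // eB mul1n.
case/andP: wQ => wphi wQ; rewrite ccount_cons //.
apply: leq_trans (leq_sum2 _ b b); rewrite eB mul1n.
by apply: leq_trans (IHQ wQ) _; rewrite leq_pmull // wcountB_gt0.
Qed.

End Soundness.

Lemma encode_sound sg psi Q : wf_cq sg psi -> wf_ucq sg Q ->
  ucq_le_all sg [:: psi] Q ->
  ucq_le_all (world_sig sg) [:: small sg psi] [:: big sg.2 psi Q].
Proof.
move=> wpsi wQ leQ D; rewrite /ucq_count /= !addn0.
rewrite cq_count_small // cq_count_big //.
(* If a required fact is missing, the small count is 0. *)
case: and3P => [[/allP gB eba eab]|_]; last by rewrite mul0n.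
rewrite mul1n (bigD1 (cA D)) //= eba mul1n; apply: leq_trans (leq_addr _ _).
have [ab|neq] := eqVneq (cA D) (cB D).
  by rewrite ab; apply: ccount_ge_collapsed.
apply: leq_trans (ccount_ge gB wpsi wQ eba eab neq); rewrite wcount_sum.
apply: leq_isum => g _; rewrite leq_mul2l; apply/orP; right.
by have := leQ (world (cA D) g); rewrite {1}/ucq_count /= addn0.
Qed.

(** * The encoding reflects containment *)

Section Completeness.
Variables (sg : signature) (D : structure sg).
Notation n := (sz D).
Notation m := sg.2.
Notation V := 'I_(n + 2).

Let emb : 'I_n -> V := @lshift n 2.
Let a : V := rshift n (@Ordinal 2 0 isT).
Let b : V := rshift n (@Ordinal 2 1 isT).

Definition uninj (y : V) : option 'I_n :=
  if fintype.split y is inl i then Some i else None.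

Definition cvals : seq V := [seq emb (@cst _ D c) | c <- enum 'I_m].

(* Relation 0 is E, relation 1 is W, and relation j.+2 is relation j of [D] with
   a world argument. *)
Definition canon_rels (i : nat) (t : seq V) : bool :=
  match i, t with
  | 0, _ => t \in [:: [:: a; b; a]; [:: a; a; b]; [:: b; b; b]]
  | 1, _ => t \in [:: a :: cvals; nseq m.+1 b]
  | j.+2, w :: s =>
      [&& w == a, all (fun y => uninj y != None) s & @rels _ D j (pmap uninj s)]
      || (w == b) && all (pred1 b) s
  | _, _ => false
  end.

Definition canon : structure (world_sig sg) :=
  @Structure (world_sig sg) (n + 2) canon_rels
    (fun c : 'I_2 => if val c == 0 then a else b).

Lemma neq_ab : (a == b) = false.
Proof. by apply/eqP => /(congr1 val) /eqP; rewrite /= eqn_add2l. Qed.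

Lemma neq_ba : (b == a) = false.
Proof. by rewrite eq_sym neq_ab. Qed.

Lemma uninjK x : uninj (emb x) = Some x.
Proof. by rewrite /uninj (unsplitK (inl x)). Qed.

Lemma uninj_some y : uninj y != None -> exists x, y = emb x.
Proof.
rewrite /uninj; case: fintype.splitP => // i ei _; exists i; exact: val_inj.
Qed.

Lemma pmap_eq_map (T : eqType) (g : nat -> option T) (p : nat -> T) s :
  {in s, forall v, g v != None} -> pmap g s = map p s ->
  {in s, forall v, g v = Some (p v)}.
Proof.
elim: s => //= v s IHs gs; have := gs v (mem_head _ _); case gv: (g v) => [y|] //= _.
case=> yv eqs u; rewrite inE => /predU1P[->|us]; first by rewrite gv yv.
by apply: IHs us => // w ws; apply: gs; rewrite inE ws orbT.
Qed.

(** All facts of world [b] have only [b] as arguments, so old constants and variables are forced to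
    [b]. *)
Lemma wcountB_le1 q : @wcount sg canon b q <= 1.
Proof.
rewrite /wcount (@isum_point _ (fun=> b)) ?iota_uniq //; last first.
  move=> g [_ gs]; rewrite muln_eq0 negb_or => /andP[Rg _].
  apply: pmap_eq_map gs _; move: Rg; rewrite eqb0 negbK /= !inE.
  rewrite eqseq_cons neq_ba /= -[b :: nseq m b]/(nseq m.+1 b) => /eqP[->].
  have nseqE s : nseq (size s) b = map (fun=> b) s by elim: s => //= c s ->.
  by rewrite -nseqE size_iota.
rewrite -[1]/(1 * 1); apply: leq_mul; first exact: leq_b1.
rewrite cq_countE (@isum_point _ (fun=> b)) ?undup_uniq ?leq_b1 // => h [_ hs].
rewrite eqb0 negbK => /allP hq v vq; have := hs v vq.
move: vq; rewrite mem_cq_vars => /hasP[atm qa va].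
have /andP[_ /=] := hq _ qa; rewrite neq_ba eqxx /= => /allP Hb.
case hv: (h v) => [y|] // _; congr Some; apply/eqP/Hb.
by rewrite mem_pmap; apply/mapP; exists (h v) => //; apply/mapP; exists (inl v).
Qed.

Let cenv (c : nat) : V := if insub c is Some i then emb (@cst _ D i) else a.

Lemma cvalsE : cvals = map cenv (iota 0 m).
Proof.
rewrite -val_enum_ord -map_comp; apply: eq_map => c.
by rewrite /cenv /= valK.
Qed.

(** World [a] of [canon] is a copy of [D] along [emb]. *)
Lemma holds_lift g h q : wf_cq sg q -> {in iota 0 m, forall c, g c = Some (cenv c)} ->
  @holds _ (@world sg canon a g) (fun v => omap emb (h v)) q = @holds _ D h q.
Proof.
move=> /allP wq gc; apply: eq_in_all => atm qa; rewrite /sat.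
have -> : map (@ev _ (@world sg canon a g) (fun v => omap emb (h v))) atm.2 =
    map (omap emb) (map (@ev _ D h) atm.2).
  rewrite -map_comp; apply/eq_in_map => -[v|c] //= ta.
  have /and3P[_ _ /allP/(_ _ ta) /= ltc] := wq _ qa.
  rewrite insubT /= gc ?mem_iota //= /cenv; case: insubP => [i _ ei|]; last by rewrite ltc.
  by congr (Some (emb (cst _ _))); apply: val_inj.
set ts := map _ atm.2; rewrite all_map -(eq_all (a1 := fun o => o != None)); last by case.
congr andb; have -> : pmap id (map (omap emb) ts) = map emb (pmap id ts).
  by elim: ts => //= -[x|] s ->.
rewrite /= eqxx neq_ab /= orbF (map_pK uninjK) all_map.
by rewrite (eq_all (a2 := predT)) ?all_predT // => x; rewrite /= uninjK.
Qed.

(** Each sum splits into the embedded points and the two new ones; terms at new points vanish by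
    hypothesis. *)
Lemma isum_lift vs (F : (nat -> option V) -> nat) h : uniq vs ->
  (forall g, extends vs (fun v => omap emb (h v)) g -> F g != 0 ->
    {in vs, forall v, exists x, g v = Some (emb x)}) ->
  isum vs F (fun v => omap emb (h v)) =
  isum vs (fun g => F (fun v => omap emb (g v))) h.
Proof.
elim: vs h => //= v vs IHvs h /andP[nv uvs] Fi.
rewrite big_split_ord /= [X in _ + X]big1 ?addn0 => [|i _].
  apply: eq_bigr => x _; rewrite -IHvs //.
    congr isum; apply: functional_extensionality => u; rewrite /set_env.
    by case: (u == v).
  move=> g eg Fg u uv; apply: (Fi g _ Fg u); last by rewrite inE uv orbT.
  apply: (extends_cons_weak (x := emb x)); congr (extends _ _ _) : eg.
  by apply: functional_extensionality => u'; rewrite /set_env; case: (u' == v).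
rewrite -[RHS](isum0 vs (set_env (fun v => omap emb (h v)) v (rshift n i))).
apply: eq_isum => g /(extends_cons nv)[eg gv]; apply/eqP; apply/negPn/negP => Fg.
have [x] := Fi g eg Fg v (mem_head _ _); rewrite gv => -[/eqP].
by rewrite gtn_eqF // ltn_addr.
Qed.

(** [W] forces the old constants to their values in [D], and the atoms force the variables into the
    copy of [D]. *)
Lemma wcountA q : wf_cq sg q -> @wcount sg canon a q = cq_count D q.
Proof.
move=> wq; rewrite /wcount (@isum_point _ cenv) ?iota_uniq //; last first.
  move=> g [_ gs]; rewrite muln_eq0 negb_or => /andP[Rg _].
  apply: pmap_eq_map gs _; move: Rg; rewrite eqb0 negbK /= !inE.
  rewrite [X in _ || X]eqseq_cons neq_ab orbF => /eqP[->].
  exact: cvalsE.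
set g := assign _ _ _; have gc : {in iota 0 m, forall c, g c = Some (cenv c)}.
  by move=> c cm; rewrite /g /assign cm.
have -> : pmap g (iota 0 m) = cvals.
  rewrite cvalsE; elim: (iota 0 m) gc => //= c s IHs gc.
  rewrite gc ?mem_head //= IHs // => u us; apply: gc; by rewrite inE us orbT.
rewrite /= inE eqxx mul1n !cq_countE.
rewrite -[@no_env _]/(fun v => omap emb (@no_env _ v)) isum_lift ?undup_uniq //.
  by apply: eq_isum => h _; rewrite holds_lift.
move=> h [_ hs] /=; rewrite eqb0 negbK => /allP hq v vq; have := hs v vq.
move: vq; rewrite mem_cq_vars => /hasP[atm qa va].
have /andP[_ /=] := hq _ qa; rewrite neq_ab eqxx orbF /= => /andP[/allP Hi _].
case hv: (h v) => [y|] // _; have [|x ->] := @uninj_some y _; last by exists x.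
by apply: Hi; rewrite mem_pmap; apply/mapP; exists (h v) => //; apply/mapP; exists (inl v).
Qed.

Lemma cA_canon : cA canon = a. Proof. by []. Qed.
Lemma cB_canon : cB canon = b. Proof. by []. Qed.

(** The only edge leaving [b] is the loop in world [b], so the whole path is forced. *)
Lemma ccountB_le1 psi Q : wf_cq sg psi -> wf_ucq sg Q -> @ccount sg canon psi Q b <= 1.
Proof.
move=> wpsi; elim: Q => [|phi Q IHQ] wQ.
  rewrite ccount_nil // -[1]/(1 * 1); apply: leq_mul (leq_b1 _) (wcountB_le1 _).
case/andP: wQ => wphi wQ; rewrite ccount_cons //.
pose F x y := @wcount sg canon x phi * @ccount sg canon psi Q y.
apply: (@leq_trans (\sum_x \sum_y ((x == b) && (y == b) : nat) * F x y)).
  apply: leq_sum => x _; apply: leq_sum => y _; rewrite leq_mul2r; apply/orP; right.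
  by rewrite /= !inE !eqseq_cons neq_ba !eqxx /= andbT.
by rewrite sum2_pick /F -[1]/(1 * 1) leq_mul ?wcountB_le1 ?IHQ.
Qed.

(** In [canon] the two edges used in [ccount_ge] are the only ones leaving [a], and the factors
    taken at [b] are at most 1. *)
Lemma ccountA_le psi Q : wf_cq sg psi -> wf_ucq sg Q ->
  @ccount sg canon psi Q a <= ucq_count D Q.
Proof.
move=> wpsi; elim: Q => [|phi Q IHQ] wQ.
  (* Without a loop [E(a,a,a)], a path that never leaves [a] contributes nothing. *)
  by rewrite ccount_nil //= !inE !eqseq_cons eqxx neq_ab /= mul0n.
case/andP: wQ => wphi wQ; rewrite ccount_cons //.
pose F x y := @wcount sg canon x phi * @ccount sg canon psi Q y.
apply: (@leq_trans (\sum_x \sum_y (((x == a) && (y == b) : nat) * F x y +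
   ((x == b) && (y == a) : nat) * F x y))).
  apply: leq_sum => x _; apply: leq_sum => y _; rewrite -mulnDl leq_mul2r; apply/orP; right.
  rewrite /= !inE !eqseq_cons neq_ab eqxx !andbT /= orbF.
  by case: (_ && _); case: (_ && _).
under eq_bigr do rewrite big_split /=.
rewrite big_split /= !sum2_pick /F wcountA // leq_add //.
  by rewrite -[X in _ <= X]muln1 leq_mul ?ccountB_le1.
by rewrite -[X in _ <= X]mul1n leq_mul ?wcountB_le1 ?IHQ.
Qed.

(** All facts required by [small] hold in [canon], so its count is that of [psi] in [D]. For [big],
    [E(a,b,v)] forces [v = a], and [ccountA_le] applies. *)
Lemma canon_le psi Q : wf_cq sg psi -> wf_ucq sg Q ->
  cq_count canon (small sg psi) <= cq_count canon (big m psi Q) ->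
  cq_count D psi <= ucq_count D Q.
Proof.
move=> wpsi wQ; rewrite cq_count_small // cq_count_big // cA_canon cB_canon.
rewrite wcountA //.
have -> : all (fun i => @rels _ canon i (nseq (nth 0 (world_sig sg).1 i) b))
  (iota 0 (size (world_sig sg).1)).
  apply/allP => -[|[|i]]; rewrite mem_iota /= => lt_i.
  - by rewrite !inE eqxx !orbT.
  - by rewrite !inE eqxx !orbT.
  move: lt_i; rewrite size_map !ltnS => lt_i; rewrite (nth_map 0) //=.
  by apply/orP; right; rewrite eqxx all_nseq /= eqxx orbT.
rewrite /= !inE !eqxx !orbT mul1n => /leq_trans; apply.
apply: (@leq_trans (\sum_v (v == a) * @ccount sg canon psi Q v)).
  apply: leq_sum => v _; rewrite leq_mul2r; apply/orP; right.
  by rewrite /= !inE !eqseq_cons neq_ab neq_ba !eqxx /= andbT orbF.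
rewrite (bigD1 a) //= eqxx mul1n big1 ?addn0 ?ccountA_le // => v /negbTE ->.
by rewrite mul0n.
Qed.

End Completeness.

Lemma encode_complete sg psi Q : wf_cq sg psi -> wf_ucq sg Q ->
  ucq_le_all (world_sig sg) [:: small sg psi] [:: big sg.2 psi Q] ->
  ucq_le_all sg [:: psi] Q.
Proof.
move=> wpsi wQ leQ D; rewrite {1}/ucq_count /= addn0; apply: canon_le => //.
by have := leQ (canon D); rewrite /ucq_count /= !addn0.
Qed.

Theorem theorem1 :
  algorithmically_decidable wf_cq_cq QCP_CQ <->
  algorithmically_decidable wf_cq_ucq QCP_CQ_UCQ.
Proof.
split.
  apply: decidable_reduction computable_encode wf_encode _.
  move=> [[sg psi] Q] /andP[wpsi wQ].
  by split; [apply: encode_sound | apply: encode_complete].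
pose f (x : signature * cq * cq) : signature * cq * ucq := (x.1, [:: x.2]).
apply: (@decidable_reduction _ _ _ _ _ _ f) => // [|x].
  have Hx := computable_id (signature * cq * cq)%type.
  apply: computable_pair; first exact: computable_fst Hx.
  by apply: computable_cons (computable_snd Hx) (computable_cst _ _).
by case/andP => w1 w2; rewrite /wf_cq_ucq /= w1 w2.
Qed.
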